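(* Let $X$ be a complex Banach space, let $J$ be an interval of the form $[\alpha,\infty)$, $(\alpha,\infty)$ ($\alpha\in\mathbb R$) or $\mathbb R$, and let $\gamma\in BC(J,\mathbb C)$ satisfy: $\inf_{t\in J}|\gamma(t)|>0$; $\gamma\in MC_0(J,\mathbb C)$; and there exists $\varepsilon_0>0$ such that $\gamma_a/\gamma\in BUC(J,\mathbb C)$ for all $0<a<\varepsilon_0$. Then $BUC(J,X)+\gamma\,BUC(J,X)$ satisfies $(\Delta)$.
   Context: $X\neq\{0\}$. $BC$ and $BUC$ denote bounded continuous and bounded uniformly continuous functions; $C_0(J,Y)$ is the set of uniformly continuous $f:J\to Y$ vanishing at infinity (i.e. $f(t)\to0$ as $t\to\infty$, and also as $t\to-\infty$ if $J=\mathbb R$). $L^1_{\rm loc}(J,Y)$ is the set of all functions $f:J\to Y$ (not equivalence classes) Bochner–Lebesgue integrable over every compact interval contained in $J$. $f_a(t)=f(t+a)$; for $h>0$, $(\Delta_hf)(t)=f(t+h)-f(t)$ and $(M_hf)(t)=\frac1h\int_0^hf(t+s)\,ds$. $MA=\{f\in L^1_{\rm loc}:M_hf\in A\text{ for all }h>0\}$, so $\gamma\in MC_0(J,\mathbb C)$ means $\gamma\in L^1_{\rm loc}(J,\mathbb C)$ and $M_h\gamma\in C_0(J,\mathbb C)$ for all $h>0$. $\gamma V=\{\gamma v:v\in V\}$, $U+V=\{u+v:u\in U,v\in V\}$. A set $A\subset X^J$ satisfies $(\Delta)$ if: whenever $f\in L^1_{\rm loc}(J,X)$ and $\Delta_af\in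 A$ for all $a>0$, then $f-M_hf\in A$ for all $h>0$. *)

(* Defs.v *)
From HB Require Import structures.
From mathcomp Require Import all_boot all_order all_algebra.
From mathcomp Require Import complex.
From mathcomp Require Import all_classical all_reals all_analysis.

Set Implicit Arguments.
Unset Strict Implicit.
Unset Printing Implicit Defensive.

Import Order.TTheory GRing.Theory Num.Theory.
Import numFieldNormedType.Exports.

Local Open Scope classical_set_scope.
Local Open Scope ring_scope.
Local Open Scope complex_scope.

(* A function J -> Y is represented by a total function R -> Y whose values
   outside J are irrelevant: every class of functions below that depends on J
   only constrains the values taken on J.  For all the intervals J considered,
   t \in J and a > 0 imply t + a \in J, so the translates and the means only
   involve values on J. *)

Section Norm.
Context {R : realType} {Y : normedModType R[i]}.

(* In a normedModType over R[i], `|y| is a (real, nonnegative) element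
   of R[i]. *)
Definition rnorm (y : Y) : R := complex.Re `|y|.

End Norm.

Section BochnerIntegral.
Context {R : realType} {Y : normedModType R[i]}.
Local Notation mu := (@lebesgue_measure R).

Definition simple (s : R -> Y) : Prop :=
  finite_set (range s) /\
  forall y : Y, measurable (s @^-1` [set y] : set (measurableTypeR R)).

(* Only meaningful for a simple s and a measurable D of finite measure. *)
Definition simple_integral (D : set R) (s : R -> Y) : Y :=
  \sum_(y \in range s) (fine (mu (D `&` s @^-1` [set y])))%:C *: y.

(* The simple functions s n converge to f almost everywhere on D, and form a
   Cauchy sequence in L^1(D).  The s n are Borel measurable, and {ae mu, _}
   allows an exceptional set contained in a Borel null set, so that f is only
   required to be strongly Lebesgue measurable. *)
Definition bochner_approx (D : set R) (s : nat -> R -> Y) (f : R -> Y) : Prop :=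
  [/\ forall n, simple (s n),
      {ae mu, forall t, D t -> s n t @[n --> \oo] --> f t} &
      forall e : R, 0 < e -> exists N : nat, forall m n : nat,
        (N <= m)%N -> (N <= n)%N ->
        (\int[mu]_(t in D) (rnorm (s m t - s n t))%:E < e%:E)%E].

Definition bochner_integrable (D : set R) (f : R -> Y) : Prop :=
  exists s : nat -> R -> Y, bochner_approx D s f.

(* The limit exists and does not depend on s when Y is complete and f is
   integrable over D of finite measure; otherwise the value is a default. *)
Definition bochner_integral (D : set R) (f : R -> Y) : Y :=
  get [set I : Y | exists2 s : nat -> R -> Y,
         bochner_approx D s f & simple_integral D (s n) @[n --> \oo] --> I].

End BochnerIntegral.

Section FunctionClasses.
Context {R : realType}.

Definition admissible_interval (J : set R) : Prop :=
  [\/ exists alpha : R, J = `[alpha, +oo[%classic,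
      exists alpha : R, J = `]alpha, +oo[%classic |
      J = setT].

Context {Y : normedModType R[i]}.
Implicit Types (J : set R) (f : R -> Y) (A U V : set (R -> Y)).

Definition unif_continuous_on J f : Prop :=
  forall e : R, 0 < e -> exists2 d : R, 0 < d &
    forall s t : R, J s -> J t -> `|s - t| < d -> rnorm (f s - f t) < e.

Definition BC J : set (R -> Y) :=
  [set f | {within J, continuous f} /\ [bounded f t | t in J]].

Definition BUC J : set (R -> Y) :=
  [set f | unif_continuous_on J f /\ [bounded f t | t in J]].

Definition C0 J : set (R -> Y) :=
  [set f | [/\ unif_continuous_on J f,
               f t @[t --> +oo] --> (0 : Y) &
               J = setT -> f t @[t --> -oo] --> (0 : Y)]].

Definition L1loc J : set (R -> Y) :=
  [set f | forall a b : R, `[a, b] `<=` J -> bochner_integrable `[a, b] f].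

Definition translate (a : R) f : R -> Y := fun t => f (t + a).

Definition Delta (h : R) f : R -> Y := fun t => f (t + h) - f t.

Definition Mean (h : R) f : R -> Y :=
  fun t => (h^-1)%:C *: bochner_integral `[0, h] (fun s => f (t + s)).

Definition MClass J A : set (R -> Y) :=
  [set f | L1loc J f /\ forall h : R, 0 < h -> A (Mean h f)].

Definition sum_class J U V : set (R -> Y) :=
  [set f | exists u v, [/\ U u, V v & forall t, J t -> f t = u t + v t]].

Definition mul_class J (gamma : R -> R[i]^o) V : set (R -> Y) :=
  [set f | exists2 v, V v & forall t, J t -> f t = gamma t *: v t].

Definition satisfies_Delta J A : Prop :=
  forall f, L1loc J f ->
    (forall a : R, 0 < a -> A (Delta a f)) ->
    forall h : R, 0 < h -> A (fun t => f t - Mean h f t).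

End FunctionClasses.

(* Main.v *)
Require Import Defs.
From HB Require Import structures.
From mathcomp Require Import all_boot all_order all_algebra.
From mathcomp Require Import complex.
From mathcomp Require Import all_classical all_reals all_analysis.
From mathcomp Require Import ssrAC finmap measurable_realfun ring lra.

(** Write [A] for [BUC + gamma BUC] and [Delta_a f] for [f (t + a) - f t]. The function
    [W = f - M_h f] is the mean of [- Delta_s f] over [0 <= s <= h], and every
    [Delta_s f] belongs to [A]; the difficulty is that nothing is assumed about the
    dependence on [s]. The proof has two ingredients.

    The first is a description of [A] without reference to a decomposition. Let
    [det gamma w] be the determinant of the rows [(1, gamma t_i, w t_i)] for three points.
    A function [w = u + gamma v] in [A] is bounded, uniformly continuous on bounded
    windows, and its determinant is small on close triples, because locally [u] and [v]
    are almost constant ([sum_class_det]). Conversely ([reconstruction]) these properties,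
    the last one only near infinity, imply that [w] is in [A]. Indeed, the means of [gamma]
    over short segments vanish at infinity while [gamma] stays away from zero, so averaging
    the determinant in one variable, and then in a second one, shows that the means of [w]
    over short segments form a Cauchy family near infinity and that the remainder is
    proportional to [gamma] up to a small error. The limit of the means, glued from larger
    and larger windows ([glue_at_infinity]), is [u], and [v = (w - u) / gamma].

    The second ingredient makes these three properties uniform in [s]. Each of them is a
    family of linear tests on the values of [Delta_a f], which right-continuity reduces to
    rational points; since [f] is an almost everywhere limit of simple functions, the set
    of [a] that pass is measurable up to a null set ([ae_measurable_tests]). At level [n]
    these sets increase to [0 < a <= 4 h], so for some [n] the set has more than three
    quarters of the full measure, and every [b <= h] is then a difference of two of its
    elements ([steinhaus_uniform]). As
    [Delta_b f (t + y) = Delta_(y + b) f t - Delta_y f t],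
    the tests hold for all [b <= h] at once. The right-hand side carries weights [gamma t]
    where the left-hand side needs [gamma (t + y)]; this is where the uniform continuity of
    [gamma (t + y) / gamma t] enters ([Delta_equi_det]). What is proved so far concerns
    points [t + y], away from the finite endpoint of [J], and the identity
    [W t = W (t + H) - (Delta_H f - M_h Delta_H f) t] extends it to [J]
    ([difference_with_mean]).

    The beginning of the file develops the Bochner integral as far as the means require:
    uniqueness and existence of the limit, linearity, the bound by the supremum of the
    norm, translation, and integrability of continuous functions. *)

Import Order.TTheory GRing.Theory Num.Theory.
Import numFieldNormedType.Exports.

Local Open Scope classical_set_scope.
Local Open Scope ring_scope.
Local Open Scope complex_scope.

Set Implicit Arguments.
Unset Strict Implicit.
Unset Printing Implicit Defensive.

(** * Real-valued norms *)

Section RealNorm.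
Context {R : realType} {Y : normedModType R[i]}.
Implicit Types x y z : Y.

Lemma rnormE y : (rnorm y)%:C = `|y|.
Proof. by rewrite /rnorm RRe_real// realE normr_ge0. Qed.

Lemma rnorm_ge0 y : 0 <= rnorm y.
Proof. by rewrite -lecR rnormE normr_ge0. Qed.

Lemma rnorm_eq0 y : (rnorm y == 0) = (y == 0).
Proof. by rewrite -(inj_eq (@complexI R)) rnormE normr_eq0. Qed.

Lemma rnorm0 : rnorm (0 : Y) = 0.
Proof. by rewrite /rnorm normr0. Qed.

Lemma rnormN y : rnorm (- y) = rnorm y.
Proof. by rewrite /rnorm normrN. Qed.

Lemma rnormBC x y : rnorm (x - y) = rnorm (y - x).
Proof. by rewrite /rnorm distrC. Qed.

Lemma rnormD x y : rnorm (x + y) <= rnorm x + rnorm y.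
Proof. by rewrite -lecR rmorphD /= !rnormE ler_normD. Qed.

Lemma rnormB x y : rnorm (x - y) <= rnorm x + rnorm y.
Proof. by rewrite -(rnormN y) rnormD. Qed.

Lemma rnorm_triangle z x y : rnorm (x - y) <= rnorm (x - z) + rnorm (z - y).
Proof. by have := rnormD (x - z) (z - y); rewrite addrA subrK. Qed.

Lemma rnorm_lerB x y : rnorm x <= rnorm (x - y) + rnorm y.
Proof. by have := rnormD (x - y) y; rewrite subrK. Qed.

Lemma rnormZ (a : R[i]) y : rnorm (a *: y) = rnorm (a : R[i]^o) * rnorm y.
Proof. by apply: (@complexI R); rewrite rmorphM /= !rnormE normrZ. Qed.

Lemma rnorm_real (a : R) : rnorm (a%:C : R[i]^o) = `|a|.
Proof.
rewrite -[LHS]/(complex.Re (`|a%:C|)) normc_def /= expr0n addr0 sqrtr_sqr.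
by [].
Qed.

Lemma rnormZr (a : R) y : rnorm (a%:C *: y) = `|a| * rnorm y.
Proof. by rewrite rnormZ rnorm_real. Qed.

Lemma rnorm_sum (I : Type) (r : seq I) (P : pred I) (F : I -> Y) :
  rnorm (\sum_(i <- r | P i) F i) <= \sum_(i <- r | P i) rnorm (F i).
Proof.
elim/big_rec2: _ => [|i a b _ le_ab]; first by rewrite rnorm0.
by rewrite (le_trans (rnormD _ _))// lerD2l.
Qed.

Lemma cvg_rnormP {T : Type} (F : set_system T) (FF : Filter F)
    (f : T -> Y) (l : Y) :
  f x @[x --> F] --> l <->
  forall e : R, 0 < e -> \forall x \near F, rnorm (f x - l) < e.
Proof.
rewrite cvgrPdist_lt; split=> h e e0.
  have := h e%:C; rewrite ltcR => /(_ e0); apply: filterS => x.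
  by rewrite distrC -rnormE ltcR.
have er : e = (complex.Re e)%:C by rewrite RRe_real// gtr0_real.
rewrite er; rewrite er ltcR in e0; have := h _ e0; apply: filterS => x.
by rewrite distrC -rnormE ltcR.
Qed.

Lemma cvgn_rnormP (f : nat -> Y) (l : Y) :
  f n @[n --> \oo] --> l <->
  forall e : R, 0 < e -> exists N, forall n, (N <= n)%N -> rnorm (f n - l) < e.
Proof.
rewrite cvg_rnormP; split=> h e /h.
  by case=> N _ hN; exists N.
by case=> N hN; exists N.
Qed.

Lemma boundedP (J : set R) (f : R -> Y) :
  [bounded f t | t in J] <-> exists M : R, forall t, J t -> rnorm (f t) <= M.
Proof.
split=> [/ex_strict_bound_gt0[M _ hM]|[M hM]].
  exists (complex.Re M) => t Jt; have /ltW := hM t Jt.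
  by rewrite -rnormE lecE => /andP[_].
exists M%:C; split=> [|N MN t Jt]; first by rewrite complex_real.
by apply: le_trans (ltW MN); rewrite -rnormE lecR hM.
Qed.

End RealNorm.

Lemma rnormM {R : realType} (a b : R[i]^o) :
  rnorm (a * b : R[i]^o) = rnorm a * rnorm b.
Proof. by apply: (@complexI R); rewrite rmorphM /= !rnormE normrM. Qed.

Lemma rnormV {R : realType} (a : R[i]^o) : rnorm (a^-1 : R[i]^o) = (rnorm a)^-1.
Proof. by apply: (@complexI R); rewrite fmorphV /= !rnormE normfV. Qed.

Lemma cauchy_complete {R : realType} (X : completeNormedModType R[i])
    (s : nat -> X) :
  (forall e : R, 0 < e -> exists N, forall m n, (N <= m)%N -> (N <= n)%N ->
     rnorm (s m - s n) < e) -> exists l : X, s n @[n --> \oo] --> l.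
Proof.
move=> h; suff scvg : cvgn s by exists (limn s).
apply/cauchy_cvgP/cauchy_exP => e e0.
have er : e = (complex.Re e)%:C by rewrite RRe_real// gtr0_real.
rewrite er ltcR in e0; have [N hN] := h _ e0.
exists (s N), N => // n /= Nn.
by rewrite -ball_normE /= -rnormE er ltcR hN.
Qed.

Section Translation.
Context {R : realType}.
Local Notation mu := (@lebesgue_measure R).

Lemma measurable_shift (t : R) :
  measurable_fun [set: measurableTypeR R]
    ((fun u => t + u) : measurableTypeR R -> measurableTypeR R).
Proof.
apply: continuous_measurable_fun => x.
by apply: cvgD; [exact: cvg_cst|exact: cvg_id].
Qed.

(** Lebesgue measure and its translate agree on half-open intervals, which
    determine them. *)
Lemma lebesgue_measure_shift (t : R) (A : set (measurableTypeR R)) :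
  measurable A -> mu ((fun u => t + u) @^-1` A) = mu A.
Proof.
move=> mA; apply/esym.
pose nu : set (measurableTypeR R) -> \bar R := pushforward mu (fun u => t + u).
have nu0 : nu set0 = 0%E by rewrite /nu /pushforward preimage_set0 measure0.
have mpre B : measurable B -> measurable ((fun u => t + u) @^-1` B).
  by move=> mB; rewrite -[X in measurable X]setTI; exact: measurable_shift.
have nu_ge0 A' : (0 <= nu A')%E by rewrite /nu /pushforward measure_ge0.
have nu_sigma : semi_sigma_additive nu.
  move=> F mF tF mUF; rewrite /nu /pushforward preimage_bigcup.
  apply: measure_semi_sigma_additive.
  - by move=> n; apply: mpre; exact: mF.
  - apply/trivIsetP => /= i j _ _ ij; rewrite -preimage_setI.
    by move/trivIsetP : tF => /(_ _ _ _ _ ij) ->//; rewrite preimage_set0.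
  - by rewrite -preimage_bigcup; exact: mpre.
pose nuM := isMeasure.Build _ _ _ nu nu0 nu_ge0 nu_sigma.
pose nu' : {measure set (measurableTypeR R) -> \bar R} := HB.pack nu nuM.
apply: (@lebesgue_measure_unique R nu' _ _ mA) => X /ocitvP[->|[[a b]/= ab ->]].
  by rewrite measure0 [RHS]nu0.
have e : (fun u => t + u) @^-1` `]a, b]%classic = `](a - t), (b - t)]%classic.
  by apply/seteqP; split=> x /=; rewrite !in_itv/=; lra.
rewrite [RHS]/= [RHS](congr1 mu e).
rewrite !lebesgue_measure_itv /= !lte_fin ltrD2r ab.
by rewrite -!EFinD; congr (_%:E); lra.
Qed.

Lemma ae_shift (t : R) (P : set R) :
  {ae mu, forall u, P u} -> {ae mu, forall u, P (t + u)}.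
Proof.
move=> [N [mN N0 PN]]; exists ((fun u => t + u) @^-1` N); split.
- by rewrite -[X in measurable X]setTI; exact: measurable_shift.
- exact: (etrans (lebesgue_measure_shift t mN) N0).
- by move=> u /= nPu; exact: PN.
Qed.

Lemma integral_shift (t : R) (D : set R) (f : R -> \bar R) :
  measurable (D : set (measurableTypeR R)) ->
  measurable_fun (D : set (measurableTypeR R)) f ->
  (forall u, D u -> (0 <= f u)%E) ->
  (\int[mu]_(u in (fun u => t + u)%R @^-1` D) f (t + u)%R =
   \int[mu]_(u in D) f u)%E.
Proof.
move=> mD mf f0.
rewrite -[LHS](ge0_integral_pushforward (measurable_shift t) mu mD mf); last first.
  by move=> y /set_mem; exact: f0.
apply: eq_measure_integral => [|mt A mA AD]; first exact: measurable_shift.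
exact: lebesgue_measure_shift.
Qed.

Lemma ae_imply (P Q : R -> Prop) : (forall t, P t -> Q t) ->
  {ae mu, forall t, P t} -> {ae mu, forall t, Q t}.
Proof.
move=> PQ; have FF : Filter (almost_everywhere mu).
  exact: ae_filter_ringOfSetsType.
exact: (@filterS _ _ FF).
Qed.

Lemma ae_imply2 (P Q S : R -> Prop) : (forall t, P t -> Q t -> S t) ->
  {ae mu, forall t, P t} -> {ae mu, forall t, Q t} -> {ae mu, forall t, S t}.
Proof.
move=> PQS; have FF : Filter (almost_everywhere mu).
  exact: ae_filter_ringOfSetsType.
exact: (@filterS2 _ _ FF).
Qed.

End Translation.

(** * Functions of finite range *)

Section FiniteRange.
Context {R : realType}.
Local Notation mu := (@lebesgue_measure R).

(** Like [simple], with values in an arbitrary type: pairing two simple functions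
    then puts them over a common finite partition. *)
Definition finite_measurable (Z : Type) (z : R -> Z) : Prop :=
  finite_set (range z) /\
  forall p : Z, measurable (z @^-1` [set p] : set (measurableTypeR R)).

Lemma finite_measurable_preimage (Z : Type) (z : R -> Z) (S : set Z) :
  finite_measurable z -> measurable (z @^-1` S : set (measurableTypeR R)).
Proof.
move=> [fz mz].
have -> : z @^-1` S = \bigcup_(p in range z `&` S) (z @^-1` [set p]).
  apply/seteqP; split=> [t St|t [p [_ Sp] /= ->]]//.
  by exists (z t) => //; split.
apply: fin_bigcup_measurable => [|p _]; last exact: mz.
exact: finite_setIl.
Qed.

Lemma finite_measurable_comp (Z W : Type) (z : R -> Z) (phi : Z -> W) :
  finite_measurable z -> finite_measurable (phi \o z).
Proof.
move=> fmz; split=> [|p]; last exact: (finite_measurable_preimage (phi @^-1` [set p])).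
apply: (sub_finite_set _ (finite_image phi fmz.1)) => _ [t _ <-].
by exists (z t) => //; exists t.
Qed.

Lemma finite_measurable_pair (Z W : Type) (z : R -> Z) (w : R -> W) :
  finite_measurable z -> finite_measurable w ->
  finite_measurable (fun t => (z t, w t)).
Proof.
move=> [fz mz] [fw mw]; split=> [|[p q]].
  apply: (sub_finite_set _ (finite_setX fz fw)) => _ [t _ <-].
  by split; exists t.
have -> : (fun t => (z t, w t)) @^-1` [set (p, q)] =
    z @^-1` [set p] `&` w @^-1` [set q].
  by apply/seteqP; split=> [t /= [-> ->]|t [/= -> ->]].
by apply: measurableI; [exact: mz|exact: mw].
Qed.

Lemma finite_measurable_shift (Z : Type) (z : R -> Z) (t : R) :
  finite_measurable z -> finite_measurable (fun u => z (t + u)).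
Proof.
move=> [fz mz]; split=> [|p].
  by apply: (sub_finite_set _ fz) => _ [u _ <-]; exists (t + u).
rewrite -[X in measurable X]setTI.
exact: (measurable_shift t measurableT (mz p)).
Qed.

Lemma finite_measurable_cst (Z : Type) (p : Z) :
  finite_measurable (fun=> p : Z).
Proof.
split=> [|q]; first by apply: (sub_finite_set _ (finite_set1 p)) => _ [u _ <-].
by rewrite preimage_cst; case: ifP => _; [exact: measurableT|exact: measurable0].
Qed.

Lemma finite_measurable_fun (z : R -> R) (D : set (measurableTypeR R)) :
  finite_measurable z -> measurable_fun D (z : measurableTypeR R -> R).
Proof.
move=> fmz mD B mB; apply: measurableI => //.
exact: finite_measurable_preimage.
Qed.

Section Integral.
Variables (D : set R) (mD : measurable (D : set (measurableTypeR R))).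
Hypothesis D_fin : (mu D < +oo)%E.

Lemma fin_num_fiber (A : set R) : measurable (A : set (measurableTypeR R)) ->
  mu (D `&` A) \is a fin_num.
Proof.
move=> mA; rewrite ge0_fin_numE ?measure_ge0//.
by apply: le_lt_trans D_fin; apply: le_measure; rewrite ?inE//;
  apply/mem_set => //; exact: measurableI.
Qed.

Definition fiber_measure (Z : Type) (z : R -> Z) (p : Z) : R :=
  fine (mu (D `&` z @^-1` [set p])).

Lemma fiber_measure_comp (Z W : choiceType) (z : R -> Z) (phi : Z -> W) (y : W) :
  finite_measurable z ->
  fiber_measure (phi \o z) y =
  \sum_(p <- fset_set (range z) | phi p == y) fiber_measure z p.
Proof.
move=> fmz; have [fz mz] := fmz; rewrite /fiber_measure.
have -> : D `&` (phi \o z) @^-1` [set y] =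
    \bigcup_(p in range z `&` phi @^-1` [set y]) (D `&` z @^-1` [set p]).
  apply/seteqP; split=> [t [Dt /= e]|t [p [_ /= Sp] /= [Dt zt]]] //.
    by exists (z t) => //; split.
  by split=> //=; rewrite zt.
rewrite measure_fin_bigcup; last 3 first.
- exact: finite_setIl.
- by move=> p q _ _ [t [[_ /= <-] [_ /= <-]]].
- by move=> p _; apply: measurableI => //; exact: mz.
rewrite fsbig_mkcondr fsbig_finite//= [RHS]big_mkcond/=.
rewrite -[RHS]/(fine (_)%:E) -sumEFin; congr fine; apply: eq_bigr => p _.
have -> : (p \in phi @^-1` [set y]) = (phi p == y).
  by apply/idP/idP => [/set_mem/eqP|/eqP e]//; apply/mem_set.
by case: ifP => // _; rewrite fineK//; apply: fin_num_fiber; exact: mz.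
Qed.

Lemma ge0_integral_finite (Z : choiceType) (z : R -> Z) (phi : Z -> R) :
  finite_measurable z -> (forall p, 0 <= phi p) ->
  (\int[mu]_(t in D) (phi (z t))%:E =
   (\sum_(p <- fset_set (range z)) fiber_measure z p * phi p)%:E)%E.
Proof.
move=> fmz phi0; have [fz mz] := fmz.
have DE : D = \big[setU/set0]_(p <- fset_set (range z)) (D `&` z @^-1` [set p]).
  rewrite -bigcup_fset_set//; apply/seteqP; split=> [t Dt|t [p _ []]//].
  by exists (z t).
rewrite {1}DE ge0_integral_bigsetU//=; last 4 first.
- by move=> p; apply: measurableI => //; exact: mz.
- by move=> p q _ _ [t [[_ /= <-] [_ /= <-]]].
- apply/measurable_EFinP; apply: finite_measurable_fun.
  exact: finite_measurable_comp.
- by move=> t _; rewrite lee_fin.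
rewrite -sumEFin; apply: eq_bigr => p _.
rewrite (eq_integral (cst (phi p)%:E)); last first.
  by move=> t /set_mem [_ /= ->].
rewrite integral_cst; last by apply: measurableI => //; exact: mz.
rewrite muleC EFinM /fiber_measure fineK//.
by apply: fin_num_fiber; exact: mz.
Qed.

End Integral.
End FiniteRange.

(** * Simple approximations *)

Section SimpleIntegral.
Context {R : realType}.
Local Notation mu := (@lebesgue_measure R).
Variables (D : set R) (mD : measurable (D : set (measurableTypeR R))).
Hypothesis D_fin : (mu D < +oo)%E.

(** The integral can be computed on any partition refining the level sets. With
    [z] a pair of simple functions this gives additivity. *)
Lemma simple_integral_comp (Z : choiceType) (Y : normedModType R[i])
    (z : R -> Z) (phi : Z -> Y) : finite_measurable z ->
  simple_integral D (phi \o z) =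
  \sum_(p <- fset_set (range z)) (fiber_measure D z p)%:C *: phi p.
Proof.
move=> fmz; have [fz _] := fmz; have [fw _] := finite_measurable_comp phi fmz.
rewrite /simple_integral fsbig_finite//=.
under eq_bigr => y _.
  rewrite -/(fiber_measure D (phi \o z) y) fiber_measure_comp// rmorph_sum/=.
  rewrite scaler_suml (eq_bigr (fun p => (fiber_measure D z p)%:C *: phi p)).
    over.
  by move=> p /eqP ->.
rewrite (exchange_big_dep xpredT)//=; apply: eq_big_seq => p.
rewrite in_fset_set// => /set_mem [t _ <-].
rewrite big_mkcond (bigD1_seq (phi (z t))) ?fset_uniq//=; last first.
  by rewrite in_fset_set//; apply/mem_set; exists t.
rewrite eqxx big1 ?addr0// => y /negbTE; by rewrite eq_sym => ->.
Qed.

Lemma simple_integral_additive (Y : normedModType R[i]) (s s' : R -> Y) :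
  simple s -> simple s' ->
  simple_integral D (fun t => s t + s' t) =
  simple_integral D s + simple_integral D s'.
Proof.
move=> ss ss'; have fp := finite_measurable_pair ss ss'.
have -> : (fun t => s t + s' t) = (fun p => p.1 + p.2) \o (fun t => (s t, s' t)) by [].
have e1 : s = fst \o (fun t => (s t, s' t)) by [].
have e2 : s' = snd \o (fun t => (s t, s' t)) by [].
rewrite [in RHS]e1 [X in _ + simple_integral _ X]e2.
rewrite !simple_integral_comp// -big_split/=.
by apply: eq_bigr => p _; rewrite scalerDr.
Qed.

Lemma simple_integral_linear (Y Y' : normedModType R[i]) (L : Y -> Y')
    (s : R -> Y) : linear L -> simple s ->
  simple_integral D (L \o s) = L (simple_integral D s).
Proof.
move=> linL ss; have e : s = id \o s by [].
rewrite [in RHS]e !simple_integral_comp//.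
have L0 : L 0 = 0.
  by have := linL (-1) 0 0; rewrite scaler0 addr0 scaleN1r addNr.
elim/big_rec2: _ => [|p a b _ ->]; first by rewrite L0.
by rewrite linL.
Qed.

Lemma rnorm_simple_integral (Y : normedModType R[i]) (s : R -> Y) : simple s ->
  ((rnorm (simple_integral D s))%:E <= \int[mu]_(t in D) (rnorm (s t))%:E)%E.
Proof.
move=> ss; have e : s = id \o s by [].
rewrite (ge0_integral_finite mD D_fin ss); last exact: rnorm_ge0.
rewrite lee_fin {1}e simple_integral_comp//.
apply: le_trans (rnorm_sum _ _ _) _; apply: ler_sum => p _.
by rewrite rnormZr ger0_norm// fine_ge0// measure_ge0.
Qed.

Lemma measurable_rnorm (Y : normedModType R[i]) (s : R -> Y) E : simple s ->
  measurable_fun E (fun t : measurableTypeR R => (rnorm (s t))%:E).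
Proof.
move=> ss; apply/measurable_EFinP; apply: finite_measurable_fun.
exact: (finite_measurable_comp (@rnorm R Y) ss).
Qed.

End SimpleIntegral.

Section SimpleClosure.
Context {R : realType} {Y Y' : normedModType R[i]}.

Lemma simpleD (s s' : R -> Y) :
  simple s -> simple s' -> simple (fun t => s t + s' t).
Proof.
move=> ss ss'; exact: (finite_measurable_comp (fun p => p.1 + p.2)
  (finite_measurable_pair ss ss')).
Qed.

Lemma simple_comp (L : Y -> Y') (s : R -> Y) : simple s -> simple (L \o s).
Proof. exact: finite_measurable_comp. Qed.

Lemma simpleB (s s' : R -> Y) :
  simple s -> simple s' -> simple (fun t => s t - s' t).
Proof.
move=> ss ss'; exact: (finite_measurable_comp (fun p => p.1 - p.2)
  (finite_measurable_pair ss ss')).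
Qed.

End SimpleClosure.

Section Approximation.
Context {R : realType}.
Local Notation mu := (@lebesgue_measure R).
Variables (D : set R) (mD : measurable (D : set (measurableTypeR R))).
Hypothesis D_fin : (mu D < +oo)%E.

Lemma bochner_approxD (Y : normedModType R[i]) (s s' : nat -> R -> Y) f f' :
  bochner_approx D s f -> bochner_approx D s' f' ->
  bochner_approx D (fun n t => s n t + s' n t) (fun t => f t + f' t).
Proof.
move=> [ss sf sC] [ss' sf' sC']; split=> [n||e e0].
- exact: simpleD.
- move: sf sf'; apply: ae_imply2 => t cv cv' Dt.
  by apply: cvgD; [exact: cv|exact: cv'].
have e2 : 0 < e / 2 by rewrite divr_gt0.
have [N hN] := sC _ e2.
have [N' hN'] := sC' _ e2.
exists (maxn N N') => m n; rewrite !geq_max => /andP[Nm Nm'] /andP[Nn Nn'].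
rewrite [e in (_ < e%:E)%E]splitr EFinD.
apply: le_lt_trans (lteD (hN _ _ Nm Nn) (hN' _ _ Nm' Nn')).
rewrite -ge0_integralD//; last 4 first.
- by move=> t _; rewrite lee_fin rnorm_ge0.
- by apply: measurable_rnorm; exact: simpleB.
- by move=> t _; rewrite lee_fin rnorm_ge0.
- by apply: measurable_rnorm; exact: simpleB.
apply: ge0_le_integral => //.
- by move=> t _; rewrite lee_fin rnorm_ge0.
- apply: (@measurable_rnorm _ Y (fun t => s m t + s' m t - (s n t + s' n t))).
  by apply: simpleB; exact: simpleD.
- by apply: emeasurable_funD; apply: measurable_rnorm; exact: simpleB.
by move=> t _; rewrite -EFinD lee_fin opprD addrACA rnormD.
Qed.

Lemma bochner_approx_linear (Y Y' : normedModType R[i]) (L : Y -> Y') (C : R)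
    (s : nat -> R -> Y) f : linear L -> (forall y, rnorm (L y) <= C * rnorm y) ->
  bochner_approx D s f ->
  bochner_approx D (fun n => L \o s n) (L \o f).
Proof.
move=> linL boundL [ss sf sC].
have LB x y : L x - L y = L (x - y).
  by rewrite -[y in RHS]scale1r -scaleNr addrC [in RHS]addrC linL scaleN1r addrC.
pose C' := `|C| + 1; have C'0 : 0 < C' by rewrite ltr_wpDl.
have boundL' y : rnorm (L y) <= C' * rnorm y.
  apply: le_trans (boundL y) _; apply: ler_wpM2r; first exact: rnorm_ge0.
  by rewrite (le_trans (ler_norm _))// lerDl.
split=> [n||e e0].
- exact: simple_comp.
- move: sf; apply: ae_imply => t cv Dt; apply/cvgn_rnormP => e e0.
  have [N hN] := (cvgn_rnormP _ _).1 (cv Dt) _ (divr_gt0 e0 C'0).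
  exists N => n Nn; rewrite /= LB; apply: le_lt_trans (boundL' _) _.
  by rewrite mulrC -ltr_pdivlMr// hN.
have [N hN] := sC _ (divr_gt0 e0 C'0).
exists N => m n Nm Nn; have := hN m n Nm Nn.
have mB : measurable_fun D (fun t : measurableTypeR R => (rnorm (s m t - s n t))%:E).
  by apply: measurable_rnorm; exact: simpleB.
rewrite (_ : (e / C')%:E = (C'^-1)%:E * e%:E)%E; last by rewrite -EFinM mulrC.
rewrite lte_pdivlMl//; apply: le_lt_trans.
rewrite -ge0_integralZl//; last 2 first.
- by move=> t _; rewrite lee_fin rnorm_ge0.
- by rewrite lee_fin ltW.
apply: ge0_le_integral => //.
- by move=> t _; rewrite lee_fin rnorm_ge0.
- apply: (@measurable_rnorm _ Y' (fun t => L (s m t) - L (s n t))).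
  by apply: simpleB; exact: simple_comp.
- exact: measurable_funeM.
by move=> t _; rewrite -EFinM lee_fin /= LB.
Qed.

(** Only the excess of the norm of [s n] over [B] has to be controlled; it is at
    most the distance from [s n] to [f], whose integral is small by Fatou. *)
Lemma bochner_approx_bound (Y : normedModType R[i]) (s : nat -> R -> Y) f B :
  0 <= B -> bochner_approx D s f -> (forall t, D t -> rnorm (f t) <= B) ->
  forall e : R, 0 < e -> exists N, forall n, (N <= n)%N ->
    rnorm (simple_integral D (s n)) <= B * fine (mu D) + e.
Proof.
move=> B0 [ss sf sC] fB e e0; have [N hN] := sC e e0.
exists N => n Nn; rewrite -lee_fin.
apply: le_trans (rnorm_simple_integral mD D_fin (ss n)) _.
pose h t := Num.max (rnorm (s n t) - B) 0.
have h0 t : 0 <= h t by rewrite le_max lexx orbT.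
have mh : measurable_fun D (fun t : measurableTypeR R => (h t)%:E).
  apply/measurable_EFinP; apply: finite_measurable_fun.
  exact: (finite_measurable_comp (fun y => Num.max (rnorm y - B) 0) (ss n)).
have mB : measurable_fun D (fun t : measurableTypeR R => B%:E).
  exact: measurable_cst.
apply: (@le_trans _ _ (\int[mu]_(t in D) (B%:E + (h t)%:E))%E).
  apply: ge0_le_integral => //.
  - by move=> t _; rewrite lee_fin rnorm_ge0.
  - exact: measurable_rnorm.
  - exact: emeasurable_funD.
  by move=> t _; rewrite -EFinD lee_fin -lerBlDl le_max lexx.
rewrite ge0_integralD//; last by move=> t _; rewrite lee_fin.
rewrite integral_cst// EFinD EFinM fineK ?ge0_fin_numE//.
apply: leeD => //.
pose k m t : \bar R := (rnorm (s m t - s n t))%:E.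
have mk m : measurable_fun D (k m : measurableTypeR R -> \bar R).
  by apply: (@measurable_rnorm _ Y (fun t => s m t - s n t)); exact: simpleB.
apply: (@le_trans _ _ (\int[mu]_(t in D) limn_einf (k ^~ t))%E).
  apply: ae_ge0_le_integral => //.
  - by move=> t _; rewrite lee_fin.
  - move=> t _; rewrite limn_einf_lim; apply: lime_ge; first exact: is_cvg_einfs.
    apply: nearW => m; apply: le_ereal_inf_tmp => _ [j _ <-].
    by rewrite lee_fin rnorm_ge0.
  - rewrite /limn_einf; apply: measurableT_comp => //.
    apply: measurable_fun_limn_esup => m; apply: measurableT_comp (mk m) => //.
  move: sf; apply: ae_imply => t cv Dt.
  have kl : k m t @[m --> \oo] --> (rnorm (f t - s n t))%:E.
    apply: cvg_EFin; first by apply: nearW.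
    apply/cvgrPdist_lt => r r0.
    have [M hM] := (cvgn_rnormP _ _).1 (cv Dt) _ r0.
    exists M => // m /= Mm; apply: le_lt_trans (hM m Mm).
    rewrite ler_norml; have := rnorm_triangle (f t) (s m t) (s n t).
    have := rnorm_triangle (s m t) (f t) (s n t).
    by rewrite (rnormBC (f t) (s m t)); lra.
  rewrite (_ : limn_einf _ = (rnorm (f t - s n t))%:E); last first.
    exact: (cvg_limn_einf_sup kl).1.
  rewrite lee_fin ge_max rnorm_ge0 andbT.
  have := rnorm_lerB (s n t) (f t); have := fB t Dt.
  by rewrite rnormBC; lra.
apply: le_trans (fatou _ _ _ _) _ => //.
  by move=> m t _; rewrite lee_fin rnorm_ge0.
rewrite limn_einf_lim; apply: lime_le; first exact: is_cvg_einfs.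
apply: nearW => j; apply: ge_ereal_inf.
exists (\int[mu]_(t in D) k (maxn j N) t)%E.
  by exists (maxn j N) => //=; rewrite leq_maxl.
  by apply/ltW/hN => //; rewrite leq_maxr.
Qed.

End Approximation.

(** * The Bochner integral *)

Section HasIntegral.
Context {R : realType}.
Local Notation mu := (@lebesgue_measure R).
Variables (D : set R) (mD : measurable (D : set (measurableTypeR R))).
Hypothesis D_fin : (mu D < +oo)%E.

Definition has_integral (Y : normedModType R[i]) (f : R -> Y) (I : Y) : Prop :=
  exists2 s : nat -> R -> Y,
    bochner_approx D s f & simple_integral D (s n) @[n --> \oo] --> I.

Lemma has_integral_bound (Y : normedModType R[i]) (f : R -> Y) I B :
  0 <= B -> has_integral f I -> (forall t, D t -> rnorm (f t) <= B) ->
  rnorm I <= B * fine (mu D).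
Proof.
move=> B0 [s sf sI] fB; apply/ler_addgt0Pr => e e0.
have e2 : 0 < e / 2 by rewrite divr_gt0.
have [N hN] := bochner_approx_bound mD D_fin B0 sf fB e2.
have [N' hN'] := (cvgn_rnormP _ _).1 sI _ e2.
have := hN _ (leq_maxl N N'); have := hN' _ (leq_maxr N N').
have := rnorm_lerB I (simple_integral D (s (maxn N N'))).
by rewrite rnormBC; lra.
Qed.

Lemma has_integralD (Y : normedModType R[i]) (f g : R -> Y) I K :
  has_integral f I -> has_integral g K ->
  has_integral (fun t => f t + g t) (I + K).
Proof.
move=> [s sf sI] [s' sg sK]; exists (fun n t => s n t + s' n t).
  exact: bochner_approxD.
have [[ss _ _] [ss' _ _]] := (sf, sg).
under eq_fun => n do rewrite (simple_integral_additive mD D_fin (ss n) (ss' n)).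
by apply: cvgD.
Qed.

Lemma has_integral_linear (Y Y' : normedModType R[i]) (L : Y -> Y') C f I :
  linear L -> (forall y, rnorm (L y) <= C * rnorm y) ->
  has_integral f I -> has_integral (L \o f) (L I).
Proof.
move=> linL boundL [s sf sI]; exists (fun n => L \o s n).
  exact: bochner_approx_linear boundL sf.
have [ss _ _] := sf.
under eq_fun => n do rewrite (simple_integral_linear mD D_fin linL (ss n)).
have LB x y : L x - L y = L (x - y).
  by rewrite -[y in RHS]scale1r -scaleNr addrC [in RHS]addrC linL scaleN1r addrC.
pose C' := `|C| + 1; have C'0 : 0 < C' by rewrite ltr_wpDl.
apply/cvgn_rnormP => e e0.
have [N hN] := (cvgn_rnormP _ _).1 sI _ (divr_gt0 e0 C'0).
exists N => n Nn; rewrite LB; apply: le_lt_trans (boundL _) _.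
apply: (@le_lt_trans _ _ (C' * rnorm (simple_integral D (s n) - I))).
  apply: ler_wpM2r; first exact: rnorm_ge0.
  by rewrite (le_trans (ler_norm _))// lerDl.
by rewrite mulrC -ltr_pdivlMr// hN.
Qed.

Lemma has_integralZ (Y : normedModType R[i]) (a : R[i]) (f : R -> Y) I :
  has_integral f I -> has_integral (fun t => a *: f t) (a *: I).
Proof.
apply: (@has_integral_linear _ _ (fun y => a *: y) (rnorm (a : R[i]^o))).
  by move=> b x y; rewrite scalerDr !scalerA mulrC.
by move=> y; rewrite rnormZ.
Qed.

Lemma eq_has_integral (Y : normedModType R[i]) (f g : R -> Y) I :
  (forall t, D t -> f t = g t) -> has_integral f I -> has_integral g I.
Proof.
move=> fg [s [ss sf sC] sI]; exists s => //; split=> //.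
by move: sf; apply: ae_imply => t cv Dt; rewrite -fg//; exact: cv.
Qed.

Lemma has_integral_cst (Y : normedModType R[i]) (y : Y) :
  has_integral (fun=> y) ((fine (mu D))%:C *: y).
Proof.
have sy : simple (fun=> y : Y) by exact: finite_measurable_cst.
exists (fun n _ => y).
  split=> // [|e e0]; first by apply: aeW => t _; exact: cvg_cst.
  exists 0%N => m n _ _; under eq_integral => t _ do rewrite subrr rnorm0.
  by rewrite integral0 lte_fin.
have -> : simple_integral D (fun=> y) = (fine (mu D))%:C *: y.
  have -> : (fun=> y) = (fun=> y) \o (fun _ : R => tt) by [].
  rewrite (simple_integral_comp mD D_fin); last exact: finite_measurable_cst.
  rewrite (_ : range _ = [set tt]); last first.
    by apply/seteqP; split=> [[] _|[] _ /=]//; exists 0.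
  rewrite fset_set1 big_seq_fset1 /fiber_measure; congr ((fine (mu _))%:C *: _).
  by apply/seteqP; split=> // t [].
exact: cvg_cst.
Qed.

(** The difference of two integrals of [f] is an integral of the zero function,
    which the bound [0] forces to vanish. *)
Lemma has_integral_unique (Y : normedModType R[i]) (f : R -> Y) I K :
  has_integral f I -> has_integral f K -> I = K.
Proof.
move=> fI fK; have h := has_integralD fI (has_integralZ (-1) fK).
have : rnorm (I + -1 *: K) <= 0 * fine (mu D).
  apply: (has_integral_bound (lexx 0) h) => t _.
  by rewrite scaleN1r subrr rnorm0.
rewrite mul0r scaleN1r => le0; apply/eqP; rewrite -subr_eq0 -rnorm_eq0.
by rewrite eq_le le0 rnorm_ge0.
Qed.

Lemma has_integralE (Y : normedModType R[i]) (f : R -> Y) I :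
  has_integral f I -> bochner_integral D f = I.
Proof.
move=> fI; apply: (has_integral_unique _ fI).
exact: (@getPex _ (has_integral f) (ex_intro _ I fI)).
Qed.

Definition sequentially_complete (Y : normedModType R[i]) : Prop :=
  forall s : nat -> Y,
  (forall e : R, 0 < e -> exists N, forall m n, (N <= m)%N -> (N <= n)%N ->
     rnorm (s m - s n) < e) -> exists l : Y, s n @[n --> \oo] --> l.

Lemma bochner_integralP (Y : normedModType R[i]) (f : R -> Y) :
  sequentially_complete Y -> bochner_integrable D f ->
  has_integral f (bochner_integral D f).
Proof.
move=> compY [s sf]; have [ss _ sC] := sf.
have [I sI] : exists I : Y, simple_integral D (s n) @[n --> \oo] --> I.
  apply: compY => e e0; have [N hN] := sC e e0; exists N => m n Nm Nn.
  rewrite -lte_fin; apply: le_lt_trans (hN m n Nm Nn).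
  have -> : simple_integral D (s m) - simple_integral D (s n) =
      simple_integral D (fun t => s m t - s n t).
    have lN : linear (fun y : Y => - y) by move=> a x y; rewrite opprD scalerN.
    have := simple_integral_linear mD D_fin lN (ss n) => /= <-.
    rewrite -(simple_integral_additive mD D_fin)//.
    exact: simple_comp.
  by apply: (rnorm_simple_integral mD D_fin); exact: simpleB.
by rewrite (@has_integralE _ f I)//; exists s.
Qed.

End HasIntegral.

Lemma complete_sequentially {R : realType} (X : completeNormedModType R[i]) :
  sequentially_complete X.
Proof. by move=> s; exact: cauchy_complete. Qed.

Section ComplexModulus.
Context {R : realType}.
Implicit Types z : R[i]^o.

Lemma rnorm_ge_Re z : `|complex.Re z| <= rnorm z.
Proof. by rewrite -lecR rnormE; exact: (normc_ge_Re (z : R[i])). Qed.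

Lemma rnorm_ge_Im z : `|complex.Im z| <= rnorm z.
Proof.
rewrite -[rnorm z]/(complex.Re `|z : R[i]|) normc_def /=.
by rewrite -sqrtr_sqr; apply: ler_wsqrtr; rewrite lerDr sqr_ge0.
Qed.

Lemma rnorm_leD z : rnorm z <= `|complex.Re z| + `|complex.Im z|.
Proof.
rewrite -[rnorm z]/(complex.Re `|z : R[i]|) normc_def /=.
rewrite -[leRHS]ger0_norm ?addr_ge0// -sqrtr_sqr; apply: ler_wsqrtr.
rewrite sqrrD !real_normK ?num_real//.
by rewrite addrAC lerDl mulrn_wge0// mulr_ge0.
Qed.

(** Needed for the existence of the means of [gamma], as the target space here is
    the field of complex numbers. *)
Lemma complex_sequentially_complete :
  sequentially_complete (R[i]^o : normedModType R[i]).
Proof.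
have realC (u : nat -> R) : (forall e : R, 0 < e -> exists N, forall m n,
    (N <= m)%N -> (N <= n)%N -> `|u m - u n| < e) ->
    exists l : R, forall e : R, 0 < e -> exists N, forall n,
    (N <= n)%N -> `|u n - l| < e.
  move=> h; have ucvg : cvgn u.
    apply/cauchy_cvgP/cauchy_exP => e e0.
    have [N hN] := h _ e0; exists (u N), N => // n /= Nn.
    by rewrite -ball_normE /= hN.
  exists (limn u) => e e0.
  have /cvgrPdist_lt/(_ e e0)[N _ hN] := ucvg.
  by exists N => n Nn; rewrite distrC; exact: hN.
move=> s sC.
have ReB (z w : R[i]) : complex.Re (z - w) = complex.Re z - complex.Re w.
  by case: z w => [? ?] [].
have ImB (z w : R[i]) : complex.Im (z - w) = complex.Im z - complex.Im w.
  by case: z w => [? ?] [].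
have [|a ha] := realC (fun n => complex.Re (s n)).
  move=> e /sC[N hN]; exists N => m n Nm Nn; rewrite -ReB.
  exact: le_lt_trans (rnorm_ge_Re _) (hN m n Nm Nn).
have [|b hb] := realC (fun n => complex.Im (s n)).
  move=> e /sC[N hN]; exists N => m n Nm Nn; rewrite -ImB.
  exact: le_lt_trans (rnorm_ge_Im _) (hN m n Nm Nn).
exists (a +i* b : R[i]^o); apply/cvgn_rnormP => e e0.
have e2 : 0 < e / 2 by rewrite divr_gt0.
have [N hN] := ha _ e2; have [M hM] := hb _ e2.
exists (maxn N M) => n; rewrite geq_max => /andP[Nn Mn].
apply: le_lt_trans (rnorm_leD _) _; rewrite [ltRHS]splitr.
by rewrite ReB ImB; apply: ltrD; [exact: hN|exact: hM].
Qed.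

End ComplexModulus.

(** * Bochner integrability *)

Section Integrable.
Context {R : realType} {Y : normedModType R[i]}.
Local Notation mu := (@lebesgue_measure R).
Implicit Types (f g : R -> Y) (a b h t : R).

Lemma measure_itv a b : a <= b -> mu `[a, b] = (b - a)%:E.
Proof.
rewrite le_eqVlt => /predU1P[->|ab].
  by rewrite lebesgue_measure_itv /= ltxx subrr.
by rewrite lebesgue_measure_itv /= lte_fin ab.
Qed.

Lemma measurable_segment a b : measurable (`[a, b]%classic : set (measurableTypeR R)).
Proof. exact: measurable_itv. Qed.

Lemma finite_segment a b : (mu `[a, b] < +oo)%E.
Proof. by rewrite lebesgue_measure_itv/=; case: ifP => // _; rewrite ltry. Qed.

Lemma bochner_integrable_shift a b t f :
  bochner_integrable `[t + a, t + b] f ->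
  bochner_integrable `[a, b] (fun s => f (t + s)).
Proof.
have shiftE : (fun u => t + u) @^-1` `[t + a, t + b]%classic = `[a, b]%classic.
  by apply/seteqP; split=> x /=; rewrite !in_itv/= !lerD2l.
move=> [s [ss sf sC]]; exists (fun n u => s n (t + u)); split=> [n||e e0].
- exact: (finite_measurable_shift t (ss n)).
- move: (ae_shift t sf); apply: ae_imply => u cv Du; apply: cv.
  by rewrite -shiftE in Du.
have [N hN] := sC e e0; exists N => m n Nm Nn.
have := hN m n Nm Nn; rewrite -(integral_shift t) ?shiftE//.
- by apply: (@measurable_rnorm _ Y (fun t => s m t - s n t)); exact: simpleB.
- by move=> u _; rewrite lee_fin rnorm_ge0.
Qed.

Lemma bochner_integrable_unif (D : set R) f :
  measurable (D : set (measurableTypeR R)) -> (mu D < +oo)%E ->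
  (forall e : R, 0 < e -> exists2 s : R -> Y, simple s &
     forall t, D t -> rnorm (s t - f t) < e) ->
  bochner_integrable D f.
Proof.
move=> mD D_fin happ.
have /choice[s hs] : forall n : nat, exists s : R -> Y, simple s /\
    forall t, D t -> rnorm (s t - f t) < n.+1%:R^-1.
  move=> n; have n0 : 0 < n.+1%:R^-1 :> R by rewrite invr_gt0.
  by have [s ss sf] := happ _ n0; exists s.
have small (e : R) : 0 < e -> exists N, forall n t, (N <= n)%N -> D t ->
    rnorm (s n t - f t) < e.
  move=> e0; exists (Num.truncn e^-1) => n t Nn Dt.
  apply: lt_le_trans ((hs n).2 t Dt) _; rewrite invf_ple ?posrE//.
  by apply: le_trans (ltW (truncnS_gt _)) _; rewrite ler_nat ltnS.
exists s; split=> [n||e e0]; first exact: (hs n).1.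
  apply: aeW => t Dt; apply/cvgn_rnormP => e /small[N hN].
  by exists N => n Nn; exact: hN.
pose M := fine (mu D) + 1.
have M0 : 0 < M by rewrite ltr_wpDl// fine_ge0// measure_ge0.
have e'0 : 0 < e / (2 * M) by rewrite divr_gt0// mulr_gt0.
have [N hN] := small _ e'0; exists N => m n Nm Nn.
apply: (@le_lt_trans _ _ (\int[mu]_(t in D) (e / M)%:E)%E).
  apply: ge0_le_integral => //.
  - by move=> t _; rewrite lee_fin rnorm_ge0.
  - apply: (@measurable_rnorm _ Y (fun t => s m t - s n t)).
    by apply: simpleB; [exact: (hs m).1|exact: (hs n).1].
  move=> t Dt; rewrite lee_fin; apply: le_trans (rnorm_triangle (f t) _ _) _.
  rewrite (rnormBC (f t)); have := hN m t Nm Dt; have := hN n t Nn Dt.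
  have -> : e / M = e / (2 * M) + e / (2 * M) by field; rewrite gt_eqF.
  by lra.
rewrite integral_cst// [X in (_ * X)%E](_ : _ = (fine (mu D))%:E); last first.
  by rewrite fineK// ge0_fin_numE.
rewrite -EFinM lte_fin mulrAC ltr_pdivrMr// ltr_pM2l// /M.
by rewrite ltrDl.
Qed.

(** The step functions [t |-> f (a + i / k)], where [i] is the integer part of
    [(t - a) * k], converge uniformly to [f]. *)
Lemma continuous_bochner_integrable a b f :
  (forall e : R, 0 < e -> exists2 d : R, 0 < d & forall s t,
     a <= s <= b -> a <= t <= b -> `|s - t| < d -> rnorm (f s - f t) < e) ->
  bochner_integrable `[a, b] f.
Proof.
move=> ucf; apply: bochner_integrable_unif.
- exact: measurable_segment.
- exact: finite_segment.
move=> e /ucf[d d0 hd].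
pose k := (Num.truncn d^-1).+1; have k0 : 0 < k%:R :> R by rewrite ltr0n.
have kd : k%:R^-1 < d.
  rewrite invf_plt ?posrE//; apply: truncnS_gt.
(* clamping [t] to [[a, b]] keeps the range of [z] finite *)
pose g t : R := Num.max 0 (Num.min (t - a) (b - a)) * k%:R.
have g0 t : 0 <= g t by rewrite mulr_ge0// le_max lexx.
have mg : measurable_fun [set: measurableTypeR R] (g : measurableTypeR R -> R).
  apply: measurable_funM; last exact: measurable_cst.
  apply: measurable_maxr; first exact: measurable_cst.
  apply: measurable_minr; last exact: measurable_cst.
  by apply: measurable_funB => //; exact: measurable_cst.
pose z t : nat := Num.truncn (g t).
have fmz : finite_measurable z.
  split=> [|p].
    apply: (sub_finite_set _ (finite_II (Num.truncn (`|b - a| * k%:R)).+1)).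
    move=> _ [t _ <-] /=; rewrite ltnS; apply: le_truncn.
    by rewrite ler_pM2r// ge_max normr_ge0 ge_min ler_norm orbT.
  have -> : z @^-1` [set p] = g @^-1` `[p%:R, p.+1%:R[%classic.
    apply/seteqP; split=> t /=; rewrite in_itv/= -truncn_eq//.
      by move=> <-.
    by move=> /eqP.
  by rewrite -[X in measurable X]setTI; apply: mg => //; exact: measurable_itv.
exists ((fun i : nat => f (a + i%:R / k%:R)) \o z).
  exact: finite_measurable_comp.
move=> t /=; rewrite in_itv/= => /[dup] /andP[at_ tb] tab.
have gE : g t = (t - a) * k%:R.
  by rewrite /g min_l ?max_r ?subr_ge0// lerD2r.
have /andP[] := truncn_itv (g0 t); rewrite -/(z t) gE => zle zlt.
have le1 : (z t)%:R / k%:R <= t - a by rewrite ler_pdivrMr.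
have lt1 : t - a < (z t)%:R / k%:R + k%:R^-1.
  have -> : (z t)%:R / k%:R + k%:R^-1 = (z t).+1%:R / k%:R :> R.
    by rewrite -natr1 mulrDl mul1r.
  by rewrite ltr_pdivlMr.
have ge0 : 0 <= (z t)%:R / k%:R :> R by rewrite divr_ge0.
apply: hd => //; first by apply/andP; split; lra.
by rewrite ltr_norml; apply/andP; split; lra.
Qed.

End Integrable.

(** * Means over a segment *)

Section IsMean.
Context {R : realType}.
Implicit Types (h : R) (Y : normedModType R[i]).

Definition is_mean Y h (g : R -> Y) (m : Y) : Prop :=
  has_integral `[0, h] g (h%:C *: m).

Let seg_meas h := @measurable_segment R 0 h.
Let seg_fin h := @finite_segment R 0 h.

Lemma measure_segment h : 0 < h -> fine (lebesgue_measure `[0, h]) = h.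
Proof. by move=> h0; rewrite measure_itv ?ltW//= subr0. Qed.

Lemma is_mean_bound Y h (g : R -> Y) m B : 0 < h -> is_mean h g m ->
  (forall s, 0 <= s <= h -> rnorm (g s) <= B) -> rnorm m <= B.
Proof.
move=> h0 gm gB.
have B0 : 0 <= B.
  by apply: le_trans (rnorm_ge0 (g 0)) (gB 0 _); rewrite lexx ltW.
have := has_integral_bound (seg_meas h) (seg_fin h) B0 gm.
rewrite measure_segment// rnormZr gtr0_norm// mulrC ler_pM2r//; apply => t.
by rewrite /= in_itv/=; exact: gB.
Qed.

Lemma eq_is_mean Y h (f g : R -> Y) m : (forall s, 0 <= s <= h -> f s = g s) ->
  is_mean h f m -> is_mean h g m.
Proof. by move=> fg; apply: eq_has_integral => t; rewrite /= in_itv/=; exact: fg. Qed.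

Lemma is_meanD Y h (f g : R -> Y) m k : is_mean h f m -> is_mean h g k ->
  is_mean h (fun s => f s + g s) (m + k).
Proof. by move=> fm gk; rewrite /is_mean scalerDr; exact: has_integralD. Qed.

Lemma is_meanZ Y h (a : R[i]) (f : R -> Y) m : is_mean h f m ->
  is_mean h (fun s => a *: f s) (a *: m).
Proof.
move=> fm; rewrite /is_mean scalerA mulrC -scalerA.
exact: has_integralZ.
Qed.

Lemma is_meanB Y h (f g : R -> Y) m k : is_mean h f m -> is_mean h g k ->
  is_mean h (fun s => f s - g s) (m - k).
Proof.
move=> fm gk; rewrite -[m - k]/(m + (- k)) -scaleN1r.
apply: (eq_is_mean _ (is_meanD fm (is_meanZ (-1) gk))) => s _.
by rewrite scaleN1r.
Qed.

Lemma is_mean_scale Y h (c : R -> R[i]^o) (y : Y) m : is_mean h c m ->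
  is_mean h (fun s => c s *: y) (m *: y).
Proof.
move=> cm; rewrite /is_mean scalerA.
have linL : linear (fun a : R[i]^o => a *: y).
  by move=> a b b'; rewrite scalerDl scalerA.
apply: (has_integral_linear (seg_meas h) (seg_fin h) linL (C := rnorm y) _ cm).
by move=> a; rewrite rnormZ mulrC.
Qed.

Lemma is_mean_cst Y h (y : Y) : 0 < h -> is_mean h (fun=> y) y.
Proof.
move=> h0; rewrite /is_mean -[X in X%:C]measure_segment//.
exact: has_integral_cst.
Qed.

Lemma Mean_unique Y h (f : R -> Y) t m : 0 < h ->
  is_mean h (fun s => f (t + s)) m -> Mean h f t = m.
Proof.
move=> h0 fm; rewrite /Mean (has_integralE (seg_meas h) (seg_fin h) fm) scalerA.
by rewrite -rmorphM/= mulVf ?gt_eqF// scale1r.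
Qed.

Lemma is_mean_Mean Y h (f : R -> Y) t : sequentially_complete Y -> 0 < h ->
  bochner_integrable `[t, t + h] f -> is_mean h (fun s => f (t + s)) (Mean h f t).
Proof.
move=> compY h0 fint; rewrite /is_mean /Mean scalerA -rmorphM/= mulfV ?gt_eqF//.
rewrite scale1r; apply: bochner_integralP => //.
by apply: bochner_integrable_shift; rewrite addr0.
Qed.

End IsMean.

(** * Sets of translations measurable up to null sets *)

Section AeMeasurable.
Context {R : realType}.
Local Notation mu := (@lebesgue_measure R).

Definition ae_measurable (E : set R) : Prop :=
  exists2 B : set (measurableTypeR R),
    measurable B & {ae mu, forall a, E a <-> B a}.

Lemma measurable_ae_measurable (E : set R) :
  measurable (E : set (measurableTypeR R)) -> ae_measurable E.
Proof. by move=> mE; exists E => //; apply: aeW. Qed.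

Lemma ae_measurable_bigcap (E : nat -> set R) :
  (forall n, ae_measurable (E n)) -> ae_measurable (\bigcap_n E n).
Proof.
move=> mE.
have /choice[B hB] : forall n, exists B : set (measurableTypeR R),
    measurable B /\ {ae mu, forall a, E n a <-> B a}.
  by move=> n; have [B mB aeB] := mE n; exists B.
exists (\bigcap_n B n); first by apply: bigcapT_measurable => n; exact: (hB n).1.
have := ae_foralln (fun n => (hB n).2); apply: ae_imply => a EB.
by split=> h n _; apply/EB; exact: h.
Qed.

Lemma ae_measurableI (E F : set R) :
  ae_measurable E -> ae_measurable F -> ae_measurable (E `&` F).
Proof.
move=> [B mB EB] [C mC FC]; exists (B `&` C); first exact: measurableI.
by move: EB FC; apply: ae_imply2 => a [EB BE] [FC CF]; split=> -[]; split; auto.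
Qed.

Lemma ae_measurable_lim_le (D : set R) (p : nat -> R -> R) (q : R -> R) (e : R) :
  measurable (D : set (measurableTypeR R)) ->
  (forall n, finite_measurable (p n)) ->
  {ae mu, forall a, D a -> p n a @[n --> \oo] --> q a} ->
  ae_measurable [set a | D a /\ q a <= e].
Proof.
move=> mD fmp pq.
exists (D `&` \bigcap_j \bigcup_N \bigcap_(n in [set n | (N <= n)%N])
    (p n @^-1` [set r | r < e + j.+1%:R^-1])).
  apply: measurableI => //; apply: bigcapT_measurable => j.
  apply: bigcupT_measurable => N; apply: bigcap_measurable => [|n _].
    by exists N => /=.
  exact: finite_measurable_preimage.
move: pq; apply: ae_imply => a pq; split=> [[Da qe]|[Da h]]; split=> //.
  move=> j _; have /cvgrPdist_lt/(_ j.+1%:R^-1) := pq Da.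
  case=> [|N _ hN]; first by rewrite invr_gt0.
  exists N => // n /hN /=; rewrite ltr_norml => /andP[+ _].
  by move: j.+1%:R^-1 => r; lra.
apply/ler_addgt0Pr => r r0; have r2 : 0 < r / 2 by rewrite divr_gt0.
have /cvgrPdist_lt/(_ _ r2)[M _ hM] := pq Da.
have [N _ hN] := h (Num.truncn (r / 2)^-1) I.
have := hN _ (leq_maxl N M); have := hM _ (leq_maxr N M).
rewrite /= ltr_norml => /andP[_ hi] lo.
have : (Num.truncn (r / 2)^-1).+1%:R^-1 < r / 2.
  by rewrite invf_plt ?posrE//; exact: truncnS_gt.
by move: hi lo; move: ((Num.truncn (r / 2)^-1).+1%:R^-1) => k; lra.
Qed.

(** A variant of the Steinhaus theorem: once [E n] fills more than three
    quarters of the segment, it meets its translates by at most a quarter of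
    the length, for lack of room. *)
Lemma steinhaus_uniform (H : R) (E : nat -> set R) : 0 < H ->
  (forall n, ae_measurable (E n)) ->
  (forall m n, (m <= n)%N -> E m `<=` E n) ->
  (forall a : R, 0 < a <= H -> exists n, E n a) ->
  exists n, forall b : R, 0 <= b <= H / 4 ->
    exists y : R, [/\ 0 < y, y + b <= H, E n y & E n (y + b)].
Proof.
move=> H0 mE ndE covE.
have /choice[B hB] : forall n, exists B : set (measurableTypeR R),
    measurable B /\ {ae mu, forall a, E n a <-> B a}.
  by move=> n; have [B mB aeB] := mE n; exists B.
have [N [mN N0 EB]] := ae_foralln (fun n => (hB n).2).
have {}EB a n : ~ N a -> (E n a <-> B n a).
  by move=> Na; have := contra_notP (EB a) Na; apply.
pose C n : set (measurableTypeR R) := (`]0, H]%classic `&` B n) `\` N.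
have mC n : measurable (C n).
  apply: measurableD => //; apply: measurableI; last exact: (hB n).1.
  exact: measurable_itv.
have ndC : nondecreasing_seq C.
  move=> m n mn; apply/subsetPset => a [[Ha Bma] Na]; split=> //; split=> //.
  by apply/(EB _ _ Na); apply: ndE mn _ _; apply/(EB _ _ Na).
have UC : \bigcup_n C n = `]0, H]%classic `\` N.
  apply/seteqP; split=> [a [n _ [[Ha _] Na]]|a [Ha Na]]; first by split.
  have [|n En] := covE a; first by move: Ha; rewrite /= in_itv.
  by exists n => //; split=> //; split=> //; apply/(EB _ _ Na).
have muU : mu (\bigcup_n C n) = H%:E.
  have itvH : mu `]0, H] = H%:E by rewrite lebesgue_measure_itv/= lte_fin H0 sube0.
  rewrite UC measureD//; last by rewrite [ltLHS]itvH ltry.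
  have itvN : mu (`]0, H]%classic `&` N) = 0%E.
    apply: (subset_measure0 _ mN) => //.
    by apply: measurableI => //; exact: measurable_itv.
  by rewrite [X in (X - _)%E]itvH [X in (_ - X)%E]itvN sube0.
have cvgC : mu (C n) @[n --> \oo] --> mu (\bigcup_n C n).
  by apply: nondecreasing_cvg_mu => //; exact: bigcupT_measurable.
rewrite muU in cvgC.
have [n hn] : exists n, ((3 / 4 * H)%:E < mu (C n))%E.
  apply: contrapT => /forallNP h.
  suff : (H%:E <= (3 / 4 * H)%:E)%E by rewrite lee_fin; lra.
  rewrite -(cvg_lim _ cvgC)//; apply: lime_le; first by apply/cvg_ex; exists H%:E.
  apply: nearW => n.
  by rewrite leNgt; apply/negP; exact: h.
exists n => b /andP[b0 bH]; apply: contrapT => noy.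
pose C' : set (measurableTypeR R) := (fun u => - b + u) @^-1` C n.
have mC' : measurable C'.
  by rewrite -[X in measurable X]setTI; apply: measurable_shift.
have muC' : mu C' = mu (C n) by exact: lebesgue_measure_shift.
have dis : C n `&` C' = set0.
  apply/seteqP; split=> // x [[[xH Bx] Nx] [[yH By] Ny]].
  apply: noy; exists (- b + x); move: xH yH; rewrite /= !in_itv/= => xH yH.
  split; [lra|lra| |rewrite addrC addrA subrr add0r].
    apply/(EB (- b + x)) => //.
  apply/(EB x) => //.
(* two disjoint sets of measure above [3/4 H] in a segment of length [5/4 H] *)
have : (mu (C n `|` C') <= mu `]0%R, (5 / 4 * H)%R])%E.
  apply: le_measure; rewrite ?inE//.
  - by apply/mem_set; exact: measurableU.
  - by apply/mem_set; exact: measurable_itv.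
  have Citv (u : R) : C n u -> 0 < u <= H.
    by move=> [[+ _] _]; rewrite /= in_itv.
  move=> x Cx; rewrite /= in_itv/=; case: Cx => /Citv /andP[x0 xH];
    by apply/andP; split; lra.
rewrite (measureU mu (mC n) mC' dis) lebesgue_measure_itv/= lte_fin mulr_gt0// sube0.
rewrite [X in (_ + X)%E]muC'.
have := lteD hn hn; rewrite -EFinD => lt1 le1.
by have := lt_le_trans lt1 le1; rewrite lte_fin; lra.
Qed.

End AeMeasurable.

(** * Measurability of linear tests on the increments *)

Section Tests.
Context {R : realType} {Y : normedModType R[i]}.
Variables (J : set R) (f : R -> Y) (H : R).
Hypothesis J_up : forall t a : R, J t -> 0 <= a -> J (t + a).
Hypothesis f_L1 : L1loc J f.
Implicit Types (a t : R).

Definition lin3 (w : R -> Y) (c1 c2 c3 : R[i]^o) (t1 t2 t3 : R) : Y :=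
  c1 *: w t1 + c2 *: w t2 + c3 *: w t3.

(** As a function of [a] the test is an almost everywhere limit of functions of
    finite range, obtained from simple approximations of [f] near the three points. *)
Lemma ae_measurable_test (c1 c2 c3 : R[i]^o) t1 t2 t3 (e : R) :
  J t1 -> J t2 -> J t3 ->
  ae_measurable [set a | `[0, H]%classic a /\
    rnorm (lin3 (Delta a f) c1 c2 c3 t1 t2 t3) <= e].
Proof.
move=> Jt1 Jt2 Jt3.
have app t : J t -> exists s : nat -> R -> Y, (forall n, simple (s n)) /\
    {ae @lebesgue_measure R, forall a, `[0, H]%classic a ->
      s n a @[n --> \oo] --> f (t + a)}.
  move=> Jt; have : bochner_integrable `[0, H] (fun a => f (t + a)).
    apply: bochner_integrable_shift; apply: f_L1 => u /=; rewrite addr0 in_itv/=.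
    by move=> /andP[tu _]; rewrite -(subrK t u) addrC; apply: J_up; rewrite ?subr_ge0.
  by move=> [s [ss sf _]]; exists s.
have [s1 [ss1 sf1]] := app _ Jt1; have [s2 [ss2 sf2]] := app _ Jt2.
have [s3 [ss3 sf3]] := app _ Jt3.
pose p n a := rnorm (c1 *: (s1 n a - f t1) + c2 *: (s2 n a - f t2) +
  c3 *: (s3 n a - f t3)).
apply: (@ae_measurable_lim_le _ _ p) => [|n|]; first exact: measurable_segment.
- exact: (finite_measurable_comp
    (fun y => rnorm (c1 *: (y.1.1 - f t1) + c2 *: (y.1.2 - f t2) +
                     c3 *: (y.2 - f t3)))
    (finite_measurable_pair (finite_measurable_pair (ss1 n) (ss2 n)) (ss3 n))).
move: (ae_imply2 (fun _ => @conj _ _) sf1 sf2) sf3; apply: ae_imply2.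
move=> a [cv1 cv2] cv3 Ha.
have cv : c1 *: (s1 n a - f t1) + c2 *: (s2 n a - f t2) + c3 *: (s3 n a - f t3)
    @[n --> \oo] --> lin3 (Delta a f) c1 c2 c3 t1 t2 t3.
  apply: cvgD; first apply: cvgD; apply: cvgZr; apply: cvgB;
    by [exact: cv1|exact: cv2|exact: cv3|exact: cvg_cst].
apply/cvgrPdist_lt => r r0.
have [M hM] := (cvgn_rnormP _ _).1 cv _ r0.
exists M => // n /= Mn; apply: le_lt_trans (hM n Mn).
rewrite /p; set x := lin3 _ _ _ _ _ _ _; set y := (_ + _ + _).
have := rnorm_lerB x y; have := rnorm_lerB y x; rewrite (rnormBC x y).
by rewrite ler_norml; lra.
Qed.

Lemma cvgn_scale (c : nat -> R[i]^o) (a : R[i]^o) (w : nat -> Y) (y : Y) :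
  c n @[n --> \oo] --> a -> w n @[n --> \oo] --> y ->
  c n *: w n @[n --> \oo] --> a *: y.
Proof. exact: (@cvgZ _ _ _ \oo _ c w a y). Qed.

Definition right_seq t (u : nat -> R) : Prop :=
  (forall n, t < u n) /\ u n @[n --> \oo] --> t.

Lemma right_seq_rational t : exists q : nat -> rat, right_seq t (fun n => ratr (q n)).
Proof.
have /choice[q hq] : forall n : nat, exists q : rat, t < ratr q < t + n.+1%:R^-1.
  move=> n; have [|q /=] := @rat_in_itvoo R t (t + n.+1%:R^-1).
    by rewrite ltrDl invr_gt0.
  by rewrite in_itv/=; exists q.
exists q; split=> [n|]; first by have /andP[] := hq n.
apply/cvgrPdist_lt => e e0; exists (Num.truncn e^-1) => // n /= Nn.
have /andP[lo hi] := hq n.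
have : n.+1%:R^-1 < e.
  rewrite invf_plt ?posrE//; apply: lt_le_trans (truncnS_gt _) _.
  by rewrite ler_nat ltnS.
move: hi; move: (n.+1%:R^-1) => r hi re.
by rewrite ltr_norml; apply/andP; split; lra.
Qed.

(** Right-continuity reduces the tests to rational points, hence to countably
    many; points to the right are used because they cannot leave [J]. *)
Lemma ae_measurable_tests (Om : R -> R -> R -> Prop) (e : R)
    (c1 c2 c3 : R -> R -> R -> R[i]^o) :
  (forall t1 t2 t3, Om t1 t2 t3 -> [/\ J t1, J t2 & J t3]) ->
  (forall t1 t2 t3 u1 u2 u3, Om t1 t2 t3 ->
    right_seq t1 u1 -> right_seq t2 u2 -> right_seq t3 u3 ->
    [/\ \forall n \near \oo, Om (u1 n) (u2 n) (u3 n),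
       c1 (u1 n) (u2 n) (u3 n) @[n --> \oo] --> c1 t1 t2 t3,
       c2 (u1 n) (u2 n) (u3 n) @[n --> \oo] --> c2 t1 t2 t3 &
       c3 (u1 n) (u2 n) (u3 n) @[n --> \oo] --> c3 t1 t2 t3]) ->
  (forall a t u, 0 < a -> J t -> right_seq t u ->
     Delta a f (u n) @[n --> \oo] --> Delta a f t) ->
  ae_measurable [set a | 0 <= a <= H /\ forall t1 t2 t3, Om t1 t2 t3 ->
    rnorm (lin3 (Delta a f) (c1 t1 t2 t3) (c2 t1 t2 t3) (c3 t1 t2 t3) t1 t2 t3) <= e].
Proof.
move=> OmJ OmR fR.
pose F a t1 t2 t3 :=
  lin3 (Delta a f) (c1 t1 t2 t3) (c2 t1 t2 t3) (c3 t1 t2 t3) t1 t2 t3.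
pose q (k : nat) : rat * rat * rat :=
  odflt (0, 0, 0) (@choice.unpickle (rat * rat * rat)%type k).
pose r1 (k : nat) : R := ratr (q k).1.1; pose r2 (k : nat) : R := ratr (q k).1.2.
pose r3 (k : nat) : R := ratr (q k).2.
pose E (k : nat) : set R := if pselect (Om (r1 k) (r2 k) (r3 k)) is left _ then
  [set a | `[0, H]%classic a /\ rnorm (F a (r1 k) (r2 k) (r3 k)) <= e]
  else `[0, H]%classic.
have mE k : ae_measurable (E k).
  rewrite /E; case: pselect => [Omk|_].
    by have [? ? ?] := OmJ _ _ _ Omk; exact: ae_measurable_test.
  by apply: measurable_ae_measurable; exact: measurable_segment.
suff <- : \bigcap_k E k = [set a | 0 <= a <= H /\ forall t1 t2 t3, Om t1 t2 t3 ->
    rnorm (F a t1 t2 t3) <= e] by exact: ae_measurable_bigcap.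
apply/seteqP; split=> [a Ea|a [Ha Fa] k _]; last first.
  rewrite /E; case: pselect => [Omk|_] /=; rewrite in_itv//=; split=> //.
  exact: Fa.
have aH : 0 <= a <= H.
  by have := Ea 0%N I; rewrite /E; case: pselect => _ /=; rewrite in_itv/= => // -[].
split=> // t1 t2 t3 Omt; apply/ler_addgt0Pr => d d0.
have [Jt1 Jt2 Jt3] := OmJ _ _ _ Omt.
have [q1 R1] := right_seq_rational t1; have [q2 R2] := right_seq_rational t2.
have [q3 R3] := right_seq_rational t3.
have [OmN C1 C2 C3] := OmR _ _ _ _ _ _ Omt R1 R2 R3.
have fc t u : J t -> right_seq t u -> Delta a f (u n) @[n --> \oo] --> Delta a f t.
  move=> Jt tu; have /andP[] := aH; rewrite le_eqVlt => /predU1P[a0 _|a0 _].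
    rewrite -a0; have D0 x : Delta 0 f x = 0 by rewrite /Delta addr0 subrr.
    by rewrite D0; under eq_fun do rewrite D0; exact: cvg_cst.
  exact: fR.
have cv : F a (ratr (q1 n)) (ratr (q2 n)) (ratr (q3 n)) @[n --> \oo] --> F a t1 t2 t3.
  rewrite /F /lin3; apply: cvgD; first apply: cvgD.
  - exact: cvgn_scale C1 (fc _ _ Jt1 R1).
  - exact: cvgn_scale C2 (fc _ _ Jt2 R2).
  - exact: cvgn_scale C3 (fc _ _ Jt3 R3).
have [N2 hN2] := (cvgn_rnormP _ _).1 cv _ d0.
have [N1 _ hN1] := OmN.
pose n := maxn N1 N2; have := hN1 n (leq_maxl _ _) => /= Omn.
have qk : q (choice.pickle (q1 n, q2 n, q3 n)) = (q1 n, q2 n, q3 n).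
  by rewrite /q choice.pickleK.
have := Ea (choice.pickle (q1 n, q2 n, q3 n)) I; rewrite /E /r1 /r2 /r3 qk /=.
case: pselect => // _ [_ le_e].
apply: le_trans (rnorm_lerB _ (F a (ratr (q1 n)) (ratr (q2 n)) (ratr (q3 n)))) _.
rewrite rnormBC addrC; apply: lerD => //; apply: ltW.
by apply: hN2; exact: leq_maxr.
Qed.

End Tests.

(** * Half-lines and compact segments *)

Section Interval.
Context {R : realType}.
Variables (J : set R) (J_adm : admissible_interval J).

Lemma admissible_up (t a : R) : J t -> 0 <= a -> J (t + a).
Proof.
case: J_adm => [[al ->]|[al ->]|->] //=; rewrite !in_itv/= !andbT => ta a0; lra.
Qed.

Lemma admissible_back (H : R) : 0 <= H ->
  exists T : R, forall t, J t -> T <= `|t| -> J (t - H).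
Proof.
move=> H0; case: J_adm => [[al ->]|[al ->]|->]; last by exists 0.
  exists (`|al| + H) => t /=; rewrite !in_itv/= !andbT => alt.
  have := ler_norm al; have := ler_norm (- al); rewrite normrN => h1 h2.
  by case: (ger0P t) => t0 h; lra.
exists (`|al| + H + 1) => t /=; rewrite !in_itv/= !andbT => alt.
have := ler_norm al; have := ler_norm (- al); rewrite normrN => h1 h2.
by case: (ger0P t) => t0 h; lra.
Qed.

(** A shift to the right moves bounded parts of [J] into a compact part of [J],
    even when [J] does not contain its left endpoint. *)
Lemma admissible_window (a T : R) : 0 < a -> exists p q : R,
  `[p, q]%classic `<=` J /\ forall t, J t -> `|t| <= T -> p <= t + a <= q.
Proof.
move=> a0; case: J_adm => [[al ->]|[al ->]|->].
- exists (al + a), (T + a); split=> t /=; rewrite !in_itv/= ?andbT; first lra.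
  by move=> alt; rewrite ler_norml => /andP[h1 h2]; apply/andP; split; lra.
- exists (al + a), (T + a); split=> t /=; rewrite !in_itv/= ?andbT; first lra.
  by move=> alt; rewrite ler_norml => /andP[h1 h2]; apply/andP; split; lra.
- exists (- T + a), (T + a); split=> // t _.
  by rewrite ler_norml => /andP[h1 h2]; apply/andP; split; lra.
Qed.

Lemma C0_small {Y : normedModType R[i]} (g : R -> Y) : C0 J g ->
  forall e : R, 0 < e -> exists T : R, forall t, J t -> T <= `|t| -> rnorm (g t) < e.
Proof.
move=> [_ gp gm] e e0.
have [M [_ hM]] : \forall t \near +oo, rnorm (g t - 0) < e.
  exact: (cvg_rnormP _ _ _).1 gp e e0.
have hM' t : M < t -> rnorm (g t) < e by move=> /hM; rewrite subr0.
case: J_adm => [[al JE]|[al JE]|JE].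
- exists (`|al| + `|M| + 1) => t; rewrite JE /= in_itv/= andbT => alt h.
  apply: hM'; have := ler_norm M; have := ler_norm (- al); rewrite normrN.
  by case: (ger0P t) h => t0 h h1 h2; have := normr_ge0 al; have := normr_ge0 M; lra.
- exists (`|al| + `|M| + 1) => t; rewrite JE /= in_itv/= andbT => alt h.
  apply: hM'; have := ler_norm M; have := ler_norm (- al); rewrite normrN.
  by case: (ger0P t) h => t0 h h1 h2; have := normr_ge0 al; have := normr_ge0 M; lra.
have [M2 [_ hM2]] : \forall t \near -oo, rnorm (g t - 0) < e.
  exact: (cvg_rnormP _ _ _).1 (gm JE) e e0.
exists (`|M| + `|M2| + 1) => t _ h.
have := ler_norm M; have := ler_norm (- M2); rewrite normrN => h1 h2.
have := normr_ge0 M; have := normr_ge0 M2.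
case: (ger0P t) h => t0 h h3 h4; first by apply: hM'; lra.
by rewrite -[g t]subr0; apply: hM2; lra.
Qed.

End Interval.

Section HeineCantor.
Context {R : realType} {Y : normedModType R[i]}.

Lemma within_continuous_rnorm (J : set R) (f : R -> Y) (t : R) :
  {within J, continuous f} -> J t -> forall e : R, 0 < e ->
  exists2 d : R, 0 < d & forall s, J s -> `|s - t| < d -> rnorm (f s - f t) < e.
Proof.
move=> /subspace_continuousP cf Jt e e0.
have : nbhs t (fun s => J s -> rnorm (f s - f t) < e).
  exact: (cvg_rnormP _ _ _).1 (cf t Jt) e e0.
move=> /nbhs_ballP[d d0 hd].
by exists d => // s Js st; apply: hd => //; rewrite /ball /= distrC.
Qed.

(** Two sequences at vanishing distance with separated images would have a common
    limit point in the segment, where [f] could not be continuous. *)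
Lemma heine_cantor (J : set R) (f : R -> Y) (p q : R) :
  {within J, continuous f} -> `[p, q]%classic `<=` J ->
  forall e : R, 0 < e -> exists2 d : R, 0 < d & forall s t,
     p <= s <= q -> p <= t <= q -> `|s - t| < d -> rnorm (f s - f t) < e.
Proof.
move=> cf pqJ e e0; apply: contrapT => hN.
have /choice[st hst] : forall n : nat, exists st : R * R,
    [/\ p <= st.1 <= q, p <= st.2 <= q, `|st.1 - st.2| < n.+1%:R^-1 &
        e <= rnorm (f st.1 - f st.2)].
  move=> n; apply: contrapT => h; apply: hN; exists n.+1%:R^-1; first by rewrite invr_gt0.
  move=> s t ps pt sn; rewrite ltNge; apply/negP => le.
  by apply: h; exists (s, t).
have [phi phi_inc scv] : exists2 phi : nat -> nat, increasing_seq phi &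
    cvgn ((fun n => (st n).1) \o phi).
  apply: bolzano_weierstrass; exists (`|p| + `|q|).
  split=> [|M /ltW le_M n _ /=]; first exact: num_real.
  apply: le_trans le_M.
  have [/andP[h1 h2] _ _ _] := hst n.
  rewrite ler_norml; have := ler_norm (- p); have := ler_norm q.
  by rewrite normrN; have := normr_ge0 p; have := normr_ge0 q; lra.
move: scv => /cvg_ex[l scv].
have near_l r : 0 < r -> exists N, forall n, (N <= n)%N -> `|(st (phi n)).1 - l| < r.
  move=> r0; have /cvgrPdist_lt/(_ r r0)[N _ hN'] := scv.
  by exists N => n Nn; rewrite distrC; exact: hN'.
have lpq : p <= l <= q.
  apply/andP; split; apply/ler_addgt0Pr => r /near_l[N hN'];
    have := hN' N (leqnn N); rewrite ltr_norml => /andP[h1 h2];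
    by have [/andP[h3 h4] _ _ _] := hst (phi N); lra.
have Jl : J l by apply: pqJ; rewrite /= in_itv.
have e2 : 0 < e / 2 by rewrite divr_gt0.
have [d d0 hd] := within_continuous_rnorm cf Jl e2.
have d2 : 0 < d / 2 by rewrite divr_gt0.
have [N hN'] := near_l _ d2.
pose n := maxn N (Num.truncn (d / 2)^-1).
have sn := hN' n (leq_maxl _ _).
have [s_pq t_pq st_n le_e] := hst (phi n).
have phi_ge : (n <= phi n)%N.
  elim: n {sn s_pq t_pq st_n le_e} => // k IH.
  by apply: leq_ltn_trans IH _; rewrite ltnNge -leEnat phi_inc ltnn.
have st_d : `|(st (phi n)).1 - (st (phi n)).2| < d / 2.
  apply: lt_trans st_n _; rewrite invf_plt ?posrE//.
  apply: lt_le_trans (truncnS_gt _) _; rewrite ler_nat ltnS.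
  by apply: leq_trans phi_ge; exact: leq_maxr.
have tn : `|(st (phi n)).2 - l| < d.
  apply: le_lt_trans (ler_distD (st (phi n)).1 _ _) _.
  by rewrite distrC; lra.
have f1 : rnorm (f (st (phi n)).1 - f l) < e / 2.
  by apply: hd; [apply: pqJ; rewrite /= in_itv|apply: lt_trans sn _; lra].
have f2 : rnorm (f (st (phi n)).2 - f l) < e / 2.
  by apply: hd => //; apply: pqJ; rewrite /= in_itv.
have := rnorm_triangle (f l) (f (st (phi n)).1) (f (st (phi n)).2).
by rewrite (rnormBC (f l)); lra.
Qed.

End HeineCantor.

(** * Uniform continuity on bounded windows *)

Section UniformContinuity.
Context {R : realType}.
Implicit Types (S : set R) (Y : normedModType R[i]).

Lemma ucS Y S S' (w : R -> Y) : S `<=` S' ->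
  unif_continuous_on S' w -> unif_continuous_on S w.
Proof.
move=> SS' uw e e0; have [d d0 hd] := uw e e0.
by exists d => // s t Ss St; apply: hd; exact: SS'.
Qed.

Lemma eq_uc Y S (w w' : R -> Y) : (forall t, S t -> w t = w' t) ->
  unif_continuous_on S w -> unif_continuous_on S w'.
Proof.
move=> ww' uw e e0; have [d d0 hd] := uw e e0.
by exists d => // s t Ss St; rewrite -!ww'//; exact: hd.
Qed.

Lemma uc_real S (x : R -> R) : (forall s t, S s -> S t -> `|x s - x t| <= `|s - t|) ->
  unif_continuous_on S (fun t => (x t)%:C : R[i]^o).
Proof.
move=> x1 e e0; exists e => // s t Ss St st.
by rewrite -rmorphB/= rnorm_real; apply: le_lt_trans (x1 _ _ Ss St) st.
Qed.

Lemma ucD Y S (w w' : R -> Y) : unif_continuous_on S w ->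
  unif_continuous_on S w' -> unif_continuous_on S (fun t => w t + w' t).
Proof.
move=> uw uw' e e0; have e2 : 0 < e / 2 by rewrite divr_gt0.
have [d d0 hd] := uw _ e2; have [d' d'0 hd'] := uw' _ e2.
exists (Num.min d d'); first by rewrite lt_min d0.
move=> s t Ss St; rewrite lt_min => /andP[st st'].
rewrite opprD addrACA; apply: le_lt_trans (rnormD _ _) _.
by have := hd _ _ Ss St st; have := hd' _ _ Ss St st'; lra.
Qed.

Lemma uc_scale Y S (c : R -> R[i]^o) (w : R -> Y) (C B : R) :
  (forall t, S t -> rnorm (c t) <= C) -> (forall t, S t -> rnorm (w t) <= B) ->
  unif_continuous_on S c -> unif_continuous_on S w ->
  unif_continuous_on S (fun t => c t *: w t).
Proof.
move=> cC wB uc uw e e0.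
pose M := `|C| + `|B| + 1.
have M0 : 0 < M by rewrite ltr_wpDl// addr_ge0.
have eM : 0 < e / (2 * M) by rewrite divr_gt0// mulr_gt0.
have [d d0 hd] := uc _ eM; have [d' d'0 hd'] := uw _ eM.
exists (Num.min d d'); first by rewrite lt_min d0.
move=> s t Ss St; rewrite lt_min => /andP[st st'].
have -> : c s *: w s - c t *: w t = (c s - c t) *: w s + c t *: (w s - w t).
  by rewrite scalerBl scalerBr addrA subrK.
apply: le_lt_trans (rnormD _ _) _; rewrite !rnormZ.
have CM : rnorm (c t) <= M.
  by rewrite (le_trans (cC t St))// (le_trans (ler_norm C))// /M; have := normr_ge0 B; lra.
have BM : rnorm (w s) <= M.
  by rewrite (le_trans (wB s Ss))// (le_trans (ler_norm B))// /M; have := normr_ge0 C; lra.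
have -> : e = e / (2 * M) * M + M * (e / (2 * M)) by field; rewrite gt_eqF.
apply: (@le_lt_trans _ _ (rnorm (c s - c t) * M + M * rnorm (w s - w t))).
  by apply: lerD; [exact: ler_wpM2l (rnorm_ge0 _) _ _ BM|
    exact: ler_wpM2r (rnorm_ge0 _) _ _ CM].
by apply: ltrD; [rewrite ltr_pM2r//; exact: hd|rewrite ltr_pM2l//; exact: hd'].
Qed.

Lemma uc_inv S (c : R -> R[i]^o) (m : R) : 0 < m ->
  (forall t, S t -> m <= rnorm (c t)) -> unif_continuous_on S c ->
  unif_continuous_on S (fun t => (c t)^-1 : R[i]^o).
Proof.
move=> m0 cm uc e e0; have em : 0 < e * (m * m) by rewrite !mulr_gt0.
have [d d0 hd] := uc _ em; exists d => // s t Ss St st.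
have c0 u : S u -> c u != 0.
  by move=> Su; rewrite -rnorm_eq0 gt_eqF// (lt_le_trans m0)// cm.
have -> : (c s)^-1 - (c t)^-1 = (c t - c s) * ((c s)^-1 * (c t)^-1) :> R[i]^o.
  by field; rewrite !c0.
rewrite !rnormM !rnormV rnormBC -invfM.
rewrite ltr_pdivrMr ?mulr_gt0 ?(lt_le_trans m0 (cm _ _))//.
apply: lt_le_trans (hd _ _ Ss St st) _; apply: ler_wpM2l; first exact: ltW.
by apply: ler_pM; [exact: ltW|exact: ltW|exact: cm|exact: cm].
Qed.

Lemma uc_shift Y S S' (w : R -> Y) a : (forall t, S t -> S' (t + a)) ->
  unif_continuous_on S' w -> unif_continuous_on S (fun t => w (t + a)).
Proof.
move=> SS' uw e e0; have [d d0 hd] := uw e e0.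
exists d => // s t Ss St st; apply: hd; [exact: SS'|exact: SS'|].
by rewrite opprD addrACA subrr addr0.
Qed.

End UniformContinuity.

Section LocalUniformContinuity.
Context {R : realType}.
Variable J : set R.

(** On an open half-line this is more than continuity: it controls the oscillation
    at the finite endpoint. *)
Definition luc {Y : normedModType R[i]} (w : R -> Y) : Prop :=
  forall T : R, unif_continuous_on (J `&` [set t | `|t| <= T]) w.

Lemma luc_uc {Y : normedModType R[i]} (w : R -> Y) : luc w ->
  (forall e : R, 0 < e -> exists2 d : R, 0 < d & exists T : R, forall s t,
     J s -> J t -> T <= `|s| -> T <= `|t| -> `|s - t| < d -> rnorm (w s - w t) < e) ->
  unif_continuous_on J w.
Proof.
move=> lw aw e e0; have [d d0 [T hT]] := aw e e0.
have [d' d'0 hd'] := lw (T + 1) e e0.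
exists (Num.min 1 (Num.min d d')); first by rewrite !lt_min ltr01 d0.
move=> s t Js Jt; rewrite !lt_min => /and3P[st1 std std'].
have s_t : `|s| <= `|s - t| + `|t| by have := ler_normD (s - t) t; rewrite subrK.
have t_s : `|t| <= `|s - t| + `|s|.
  by have := ler_normD (t - s) s; rewrite subrK distrC.
have [sT|Ts] := ltP `|s| T; first by apply: hd' => //; split => //=; lra.
have [tT|Tt] := ltP `|t| T; first by apply: hd' => //; split => //=; lra.
exact: hT.
Qed.

Lemma luc_right_cvg {Y : normedModType R[i]} (w : R -> Y) t u :
  (forall t a : R, J t -> 0 <= a -> J (t + a)) ->
  luc w -> J t -> right_seq t u -> w (u n) @[n --> \oo] --> w t.
Proof.
move=> Jup lw Jt [tu ut]; apply/cvgn_rnormP => e e0.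
have [d d0 hd] := lw (`|t| + 1) e e0.
have dm : 0 < Num.min d 1 by rewrite lt_min d0 ltr01.
have /cvgrPdist_lt/(_ _ dm)[N _ hN] := ut.
exists N => n /hN /=; rewrite lt_min => /andP[h1 h2].
have u_t : `|u n| <= `|t - u n| + `|t|.
  by have := ler_normD (u n - t) t; rewrite subrK distrC.
apply: hd; last by rewrite distrC.
- split=> /=; last lra.
  by rewrite -(subrK t (u n)) addrC; apply: Jup => //; rewrite subr_ge0 ltW.
- by split=> //=; lra.
Qed.

Lemma luc_L1loc {Y : normedModType R[i]} (w : R -> Y) : luc w -> L1loc J w.
Proof.
move=> lw a b abJ; apply: continuous_bochner_integrable => e e0.
have [d d0 hd] := lw (`|a| + `|b|) e e0; exists d => // s t sab tab.
have ab_le x : a <= x <= b -> `|x| <= `|a| + `|b|.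
  move=> /andP[ax xb]; rewrite ler_norml; have := ler_norm (- a).
  by rewrite normrN; have := ler_norm b; have := normr_ge0 a; have := normr_ge0 b; lra.
by apply: hd; split=> /=; rewrite ?ab_le//; apply: abJ; rewrite /= in_itv.
Qed.

Section Mean.
Context {Y : normedModType R[i]}.
Hypothesis Y_complete : sequentially_complete Y.
Hypothesis J_up : forall t a : R, J t -> 0 <= a -> J (t + a).
Implicit Types (w : R -> Y) (t h : R).

Lemma L1loc_is_mean w t h : L1loc J w -> J t -> 0 < h ->
  is_mean h (fun s => w (t + s)) (Mean h w t).
Proof.
move=> wL Jt h0; apply: is_mean_Mean => //; apply: wL => s; rewrite /= in_itv/=.
by move=> /andP[ts _]; rewrite -(subrK t s) addrC; apply: J_up; rewrite ?subr_ge0.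
Qed.

Lemma Mean_bounded w t h B : L1loc J w -> (forall s, J s -> rnorm (w s) <= B) ->
  J t -> 0 < h -> rnorm (Mean h w t) <= B.
Proof.
move=> wL wB Jt h0; apply: (is_mean_bound h0 (L1loc_is_mean wL Jt h0)).
by move=> s /andP[s0 _]; apply: wB; exact: J_up.
Qed.

Lemma luc_Mean w h : luc w -> 0 < h -> luc (Mean h w).
Proof.
move=> lw h0 T e e0; have e2 : 0 < e / 2 by rewrite divr_gt0.
have [d d0 hd] := lw (T + h) _ e2; exists d => // s t [Js /= sT] [Jt /= tT] st.
apply: (@le_lt_trans _ _ (e / 2)); last by lra.
have wL := luc_L1loc lw.
apply: (is_mean_bound h0 (is_meanB (L1loc_is_mean wL Js h0) (L1loc_is_mean wL Jt h0))).
have near_T x r : `|x| <= T -> 0 <= r <= h -> `|x + r| <= T + h.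
  move=> xT /andP[r0 rh]; apply: le_trans (ler_normD _ _) _.
  by rewrite (ger0_norm r0); lra.
move=> r rh; have /andP[r0 _] := rh; apply/ltW/hd.
- by split=> /=; [exact: J_up|exact: near_T].
- by split=> /=; [exact: J_up|exact: near_T].
- by rewrite opprD addrACA subrr addr0.
Qed.

End Mean.
End LocalUniformContinuity.

(** * Gluing at infinity *)

Section Gluing.
Context {R : realType} {Y : normedModType R[i]}.
Variables (J : set R) (p : nat -> R -> Y) (B : R).
Hypothesis p_luc : forall n, luc J (p n).
Hypothesis p_bounded : forall n t, J t -> rnorm (p n t) <= B.

(** Completeness at infinity: the limit follows [p (m n)] on larger and larger
    windows and passes from [p (m n)] to [p (m n.+1)] by a Lipschitz cutoff [chi n],
    so that on every bounded window it is one of the partial sums [S n]. *)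
Lemma glue_at_infinity :
  (forall e : R, 0 < e -> exists N, forall m n, (N <= m)%N -> (N <= n)%N ->
     exists T : R, forall t, J t -> T <= `|t| -> rnorm (p m t - p n t) < e) ->
  exists u : R -> Y, [/\ luc J u, exists C : R, forall t, J t -> rnorm (u t) <= C &
    forall e : R, 0 < e -> exists N, forall n, (N <= n)%N ->
     exists T : R, forall t, J t -> T <= `|t| -> rnorm (u t - p n t) < e].
Proof.
move=> pC; pose r (n : nat) : R := 2^-1 ^+ n.
have r0 n : 0 < r n by rewrite exprn_gt0// invr_gt0.
have rS n : r n = 2 * r n.+1 by rewrite /r exprS; field.
have /choice[N hN] : forall j : nat, exists N : nat, forall m n, (N <= m)%N -> (N <= n)%N ->
     exists T : R, forall t, J t -> T <= `|t| -> rnorm (p m t - p n t) < r j.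
  by move=> j; have [N hN] := pC _ (r0 j); exists N.
pose m (j : nat) : nat := (\sum_(i < j.+1) N i)%N.
have Nm j : (N j <= m j)%N by rewrite /m big_ord_recr leq_addl.
have mm j : (m j <= m j.+1)%N by rewrite [m j.+1]/m big_ord_recr leq_addr.
have /choice[T hT] : forall j : nat, exists T : R, forall t, J t -> T <= `|t| ->
    rnorm (p (m j.+1) t - p (m j) t) < r j.
  by move=> j; apply: hN => //; exact: leq_trans (mm j).
pose tau (j : nat) : R := Num.max (T j) j%:R.
pose chi (j : nat) (t : R) : R := Num.max 0 (Num.min 1 (`|t| - tau j)).
have chi_bound j t : 0 <= chi j t <= 1.
  by rewrite le_max lexx/= ge_max ler01 ge_min lexx.
have chi0 j t : `|t| <= j%:R -> chi j t = 0.
  move=> tj; apply/max_idPl; rewrite ge_min subr_le0 le_max tj !orbT.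
  by [].
have chi1 j t : tau j + 1 <= `|t| -> chi j t = 1.
  move=> tj; have h : 1 <= `|t| - tau j by lra.
  by rewrite /chi min_l// max_r.
have chi_lip j s t : `|chi j s - chi j t| <= `|s - t|.
  have h1 : `|s| <= `|s - t| + `|t| by have := ler_normD (s - t) t; rewrite subrK.
  have h2 : `|t| <= `|s - t| + `|s|.
    by have := ler_normD (t - s) s; rewrite subrK distrC.
  have h3 := normr_ge0 (s - t); rewrite ler_norml /chi.
  case: (lerP 1 (`|s| - tau j)) => a1; case: (lerP 1 (`|t| - tau j)) => a2;
  rewrite ?(max_r ler01);
  try (case: (lerP 0 (`|s| - tau j)) => a3);
  try (case: (lerP 0 (`|t| - tau j)) => a4); apply/andP; split; lra.
pose d (j : nat) (t : R) : Y := p (m j.+1) t - p (m j) t.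
pose S (n : nat) (t : R) : Y := p (m 0%N) t + \sum_(j < n) (chi j t)%:C *: d j t.
have SS n t : S n.+1 t = S n t + (chi n t)%:C *: d n t.
  by rewrite /S big_ord_recr addrA.
have d_le j t : J t -> rnorm ((chi j t)%:C *: d j t) <= r j.
  move=> Jt; rewrite rnormZr ger0_norm; last by have /andP[] := chi_bound j t.
  have [tj|jt] := leP `|t| (tau j).
    have -> : chi j t = 0.
      by apply/max_idPl; rewrite ge_min subr_le0 tj orbT.
    by rewrite mul0r ltW.
  have dr : rnorm (d j t) < r j.
    by apply: hT => //; apply: ltW; apply: le_lt_trans jt; rewrite le_max lexx.
  have /andP[c0 c1] := chi_bound j t.
  apply: le_trans (ler_wpM2r (rnorm_ge0 _) c1) _; rewrite mul1r; exact: ltW.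
have S_tail n k t : J t -> rnorm (S (n + k)%N t - S n t) <= 2 * r n - 2 * r (n + k)%N.
  move=> Jt; elim: k => [|k IH]; first by rewrite addn0 !subrr rnorm0.
  rewrite addnS SS addrAC; apply: le_trans (rnormD _ _) _.
  have := d_le (n + k)%N t Jt; have := rS (n + k)%N.
  by move: IH; lra.
have S_luc n : luc J (S n).
  elim: n => [|n IH].
    move=> T0; apply: eq_uc (p_luc (m 0%N) T0) => t _.
    by rewrite /S big_ord0 addr0.
  move=> T0; apply: eq_uc (fun t _ => esym (SS n t)) _.
  apply: ucD; first exact: IH.
  apply: (@uc_scale _ _ _ (fun t => (chi n t)%:C) (d n) 1 (B + B)).
  - move=> t _; rewrite rnorm_real ger0_norm; first by have /andP[] := chi_bound n t.
    by have /andP[] := chi_bound n t.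
  - by move=> t [Jt _]; apply: le_trans (rnormB _ _) _; rewrite lerD// p_bounded.
  - by apply: uc_real => s t _ _; exact: chi_lip.
  apply: ucD; first exact: p_luc.
  move=> e e0; have [d0 d00 hd] := p_luc (m n) T0 e0; exists d0 => // s t Ss St st.
  by rewrite -opprD rnormN; exact: hd.
pose u (t : R) : Y := S (Num.truncn `|t|).+1 t.
have uS n t : J t -> `|t| <= n%:R -> u t = S n t.
  move=> Jt tn.
  have Sk k j : `|t| <= k%:R -> S (k + j)%N t = S k t.
    move=> tk; elim: j => [|j IH]; first by rewrite addn0.
    rewrite addnS SS IH chi0 ?scale0r ?addr0//.
    by apply: le_trans tk _; rewrite ler_nat leq_addr.
  have tt : `|t| <= (Num.truncn `|t|).+1%:R by exact/ltW/truncnS_gt.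
  rewrite /u; have [le|/ltnW le] := leqP n (Num.truncn `|t|).+1.
    by rewrite -(subnKC le) Sk.
  by rewrite -[in RHS](subnKC le) Sk.
exists u; split=> [T0 e e0||e e0].
- have [d0 d00 hd] := S_luc (Num.truncn T0).+1 T0 e e0; exists d0 => // s t Ss St.
  have T0_lt : T0 < (Num.truncn T0).+1%:R by exact: truncnS_gt.
  rewrite (uS (Num.truncn T0).+1 s Ss.1) ?(uS (Num.truncn T0).+1 t St.1); first exact: hd.
  + by apply: le_trans St.2 _; exact: ltW.
  + by apply: le_trans Ss.2 _; exact: ltW.
- exists (B + 2) => t Jt; rewrite /u.
  have := S_tail 0%N (Num.truncn `|t|).+1 t Jt; rewrite add0n.
  have S0 : S 0%N t = p (m 0%N) t by rewrite /S big_ord0 addr0.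
  have := rnorm_lerB (S (Num.truncn `|t|).+1 t) (S 0%N t).
  rewrite S0; have := p_bounded (m 0%N) Jt; have := r0 (Num.truncn `|t|).+1.
  have r01 : r 0%N = 1 by rewrite /r expr0.
  by rewrite r01; lra.
have S_far n : exists T0 : R, forall t, T0 <= `|t| -> S n t = p (m n) t.
  elim: n => [|n [T0 IH]]; first by exists 0 => t _; rewrite /S big_ord0 addr0.
  exists (Num.max T0 (tau n + 1)) => t; rewrite ge_max => /andP[t1 t2].
  by rewrite SS IH// chi1// scale1r addrC subrK.
have e3 : 0 < e / 3 by rewrite divr_gt0.
have half1 : `|2^-1 : R| < 1 by rewrite ger0_norm ?invr_ge0//; lra.
have /cvgrPdist_lt/(_ _ e3)[j _ hj] := cvg_expr half1.
have {hj} rj : r j < e / 3.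
  by have := hj j (leqnn j); rewrite sub0r normrN gtr0_norm//; exact: r0.
exists (m j) => n mn.
have [T0 hT0] := S_far j.
have [T1 hT1] := hN j (m j) n (Nm j) (leq_trans (Nm j) mn).
exists (Num.max T0 T1) => t Jt; rewrite ge_max => /andP[t0 t1].
have uj : u t = S (j + (Num.truncn `|t|).+1)%N t.
  apply: uS => //; apply: le_trans (ltW (truncnS_gt _)) _.
  by rewrite ler_nat leq_addl.
have := S_tail j (Num.truncn `|t|).+1 t Jt; rewrite -uj hT0//.
have := hT1 t Jt t1; have := r0 (j + (Num.truncn `|t|).+1)%N.
have := rnorm_triangle (p (m j) t) (u t) (p n t).
by lra.
Qed.

End Gluing.

(** * Reconstruction of the two components *)

(** Up to sign, the determinant of the rows [(1, gamma t_i, w t_i)]. If [gamma] is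
    not constant, it vanishes at all triples exactly when [w] is [x + gamma y] for
    constant vectors [x] and [y]; so its smallness on close triples says that [w] is
    locally close to this form. *)
Definition det {R : realType} {Y : normedModType R[i]} (gamma : R -> R[i]^o)
    (w : R -> Y) (t1 t2 t3 : R) : Y :=
  lin3 w (gamma t2 - gamma t3) (gamma t3 - gamma t1) (gamma t1 - gamma t2) t1 t2 t3.

Section Reconstruction.
Context {R : realType} {X : completeNormedModType R[i]}.
Variables (J : set R) (J_adm : admissible_interval J).
Variables (gamma : R -> R[i]^o) (c G : R).
Hypothesis c0 : 0 < c.
Hypothesis gamma_ge : forall t, J t -> c <= rnorm (gamma t).
Hypothesis gamma_le : forall t, J t -> rnorm (gamma t) <= G.
Hypothesis gamma_luc : luc J gamma.
Hypothesis gamma_mean : forall h : R, 0 < h -> C0 J (Mean h gamma).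
Variables (W : R -> X) (B : R).
Hypothesis W_luc : luc J W.
Hypothesis W_le : forall t, J t -> rnorm (W t) <= B.
Hypothesis W_det : forall e : R, 0 < e -> exists2 d : R, 0 < d & exists T : R,
  forall t1 t2 t3, J t1 -> J t2 -> J t3 -> T <= `|t1| -> T <= `|t2| -> T <= `|t3| ->
  `|t1 - t2| < d -> `|t1 - t3| < d -> `|t2 - t3| < d ->
  rnorm (det gamma W t1 t2 t3) <= e.

Let J_up := @admissible_up R J J_adm.
Let W_L1 := luc_L1loc W_luc.
Let gamma_L1 := luc_L1loc gamma_luc.
Let W_mean t h (Jt : J t) (h0 : 0 < h) :=
  L1loc_is_mean (@complete_sequentially R X) J_up W_L1 Jt h0.
Let gamma_is_mean t h (Jt : J t) (h0 : 0 < h) :=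
  L1loc_is_mean complex_sequentially_complete J_up gamma_L1 Jt h0.

Lemma Mean_W_le t h : J t -> 0 < h -> rnorm (Mean h W t) <= B.
Proof.
by move=> Jt h0; apply: (Mean_bounded (@complete_sequentially R X) J_up W_L1 W_le).
Qed.

(** Averaging the determinant in [t3]: since the means of [gamma] vanish at
    infinity, [W t1 - Mean k W t1] and [W t2 - Mean k W t1] are proportional to
    [gamma t1] and [gamma t2]. *)
Lemma det_averaged_once (e : R) : 0 < e ->
  exists2 d : R, 0 < d & forall k : R, 0 < k -> k < d ->
  exists T : R, forall t1 t2, J t1 -> J t2 -> T <= `|t1| -> T <= `|t2| ->
    `|t1 - t2| < d ->
    rnorm (gamma t2 *: (W t1 - Mean k W t1) - gamma t1 *: (W t2 - Mean k W t1)) <= e.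
Proof.
move=> e0; have e2 : 0 < e / 2 by rewrite divr_gt0.
have [d d0 [T hT]] := W_det e2.
pose M := `|B| + 1; have M0 : 0 < M by rewrite ltr_wpDl.
have eM : 0 < e / (4 * M) by rewrite divr_gt0// mulr_gt0.
exists (d / 2) => [|k k0 kd]; first by rewrite divr_gt0.
have [T' hT'] := C0_small J_adm (gamma_mean k0) eM.
exists (Num.max T' (`|T| + d)) => t1 t2 Jt1 Jt2.
rewrite !ge_max => /andP[t1T' t1T] /andP[_ t2T] t12.
have TN := ler_norm T.
have g_small := hT' t1 Jt1 t1T'.
set g := Mean k gamma t1 in g_small *; set p := Mean k W t1.
have mean_det : is_mean k (fun r => det gamma W t1 t2 (t1 + r))
    ((gamma t2 - g) *: W t1 + (g - gamma t1) *: W t2 + (gamma t1 - gamma t2) *: p).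
  apply: is_meanD; first apply: is_meanD.
  - apply: is_mean_scale; apply: is_meanB; first exact: is_mean_cst.
    exact: gamma_is_mean.
  - apply: is_mean_scale; apply: is_meanB; last exact: is_mean_cst.
    exact: gamma_is_mean.
  - by apply: is_meanZ; exact: W_mean.
have : rnorm ((gamma t2 - g) *: W t1 + (g - gamma t1) *: W t2 +
    (gamma t1 - gamma t2) *: p) <= e / 2.
  apply: (is_mean_bound k0 mean_det) => r /andP[r0 rk].
  have rn : `|t1| <= `|t1 + r| + r.
    by have := ler_normB (t1 + r) r; rewrite addrK (ger0_norm r0).
  apply: hT => //; try lra; first exact: J_up.
  - by rewrite opprD addrA subrr sub0r normrN ger0_norm//; lra.
  - have -> : t2 - (t1 + r) = - (t1 - t2 + r) by ring.
    by rewrite normrN; have := ler_normD (t1 - t2) r; rewrite (ger0_norm r0); lra.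
have -> : (gamma t2 - g) *: W t1 + (g - gamma t1) *: W t2 + (gamma t1 - gamma t2) *: p
   = (gamma t2 *: (W t1 - p) - gamma t1 *: (W t2 - p)) - g *: (W t1 - W t2).
  rewrite !scalerBl !scalerBr !opprB !addrA.
  by rewrite [LHS](ACl (1*6*5*4*3*2)).
have gW : rnorm (g *: (W t1 - W t2)) <= e / 2.
  rewrite rnormZ; have W2M : rnorm (W t1 - W t2) <= 2 * M.
    have := rnormB (W t1) (W t2); have := W_le Jt1; have := W_le Jt2.
    by have := ler_norm B; rewrite /M; lra.
  have -> : e / 2 = e / (4 * M) * (2 * M) by field; rewrite gt_eqF.
  by apply: ler_pM; rewrite ?rnorm_ge0// ltW.
by have := rnorm_lerB (gamma t2 *: (W t1 - p) - gamma t1 *: (W t2 - p))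
  (g *: (W t1 - W t2)); move: gW; set x := _ - _; set y := _ *: _;
  have := rnormD (x - y) y; rewrite subrK; lra.
Qed.

(** Averaging once more, now in [t2], eliminates [W t1] too and compares two
    local means of [W], possibly over different scales. *)
Lemma means_cauchy (e : R) : 0 < e ->
  exists2 d : R, 0 < d & forall k k' : R, 0 < k -> k < d -> 0 < k' -> k' < d ->
  exists T : R, forall t t', J t -> J t' -> T <= `|t| -> T <= `|t'| ->
    `|t - t'| < d -> rnorm (Mean k' W t' - Mean k W t) < e.
Proof.
move=> e0; have e4 : 0 < e * c / 4 by rewrite divr_gt0// mulr_gt0.
have [d d0 hd] := det_averaged_once e4.
pose M := `|B| + 1; have M0 : 0 < M by rewrite ltr_wpDl.
have eM : 0 < e * c / (4 * M) by rewrite divr_gt0 ?mulr_gt0.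
exists (d / 2) => [|k k' k0 kd k'0 k'd]; first by rewrite divr_gt0.
have [|T hT] := hd k k0 _; first by lra.
have [T' hT'] := C0_small J_adm (gamma_mean k'0) eM.
exists (Num.max T' (`|T| + d)) => t t' Jt Jt'.
rewrite !ge_max => /andP[_ tT] /andP[t'T' t'T] tt'.
have TN := ler_norm T.
have g_small := hT' t' Jt' t'T'.
set g := Mean k' gamma t' in g_small *; set p := Mean k W t; set p' := Mean k' W t'.
have mean_t' : is_mean k'
    (fun r => gamma (t' + r) *: (W t - p) - gamma t *: (W (t' + r) - p))
    (g *: (W t - p) - gamma t *: (p' - p)).
  apply: is_meanB; first by apply: is_mean_scale; exact: gamma_is_mean.
  apply: is_meanZ; apply: is_meanB; first exact: W_mean.
  exact: is_mean_cst.
have : rnorm (g *: (W t - p) - gamma t *: (p' - p)) <= e * c / 4.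
  apply: (is_mean_bound k'0 mean_t') => r /andP[r0 rk].
  have rn : `|t'| <= `|t' + r| + r.
    by have := ler_normB (t' + r) r; rewrite addrK (ger0_norm r0).
  apply: hT => //; try lra; first exact: J_up.
  have -> : t - (t' + r) = t - t' - r by ring.
  by have := ler_normB (t - t') r; rewrite (ger0_norm r0); lra.
have gW : rnorm (g *: (W t - p)) <= e * c / 2.
  rewrite rnormZ; have W2M : rnorm (W t - p) <= 2 * M.
    have := rnormB (W t) p; have := W_le Jt; have := Mean_W_le Jt k0.
    by rewrite -/p; have := ler_norm B; rewrite /M; lra.
  have -> : e * c / 2 = e * c / (4 * M) * (2 * M) by field; rewrite gt_eqF.
  by apply: ler_pM; rewrite ?rnorm_ge0// ltW.
move=> le1; rewrite rnormBC in le1.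
have := rnorm_lerB (gamma t *: (p' - p)) (g *: (W t - p)); rewrite rnormZ => le2.
have : c * rnorm (p' - p) <= rnorm (gamma t) * rnorm (p' - p).
  by apply: ler_wpM2r; [exact: rnorm_ge0|exact: gamma_ge].
move=> le3; rewrite -(ltr_pM2l c0) [c * e]mulrC.
have ec : 0 < e * c by rewrite mulr_gt0.
by lra.
Qed.

(** Once the means of [W] are known to vary slowly, [det_averaged_once] says that
    [W - Mean k W] is slowly varying relative to [gamma]. *)
Lemma remainders_cauchy (e : R) : 0 < e ->
  exists2 d : R, 0 < d & forall k : R, 0 < k -> k < d ->
  exists T : R, forall t1 t2, J t1 -> J t2 -> T <= `|t1| -> T <= `|t2| ->
    `|t1 - t2| < d ->
    rnorm (gamma t2 *: (W t1 - Mean k W t1) - gamma t1 *: (W t2 - Mean k W t2)) < e.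
Proof.
move=> e0; have e2 : 0 < e / 2 by rewrite divr_gt0.
have [d d0 hd] := det_averaged_once e2.
pose M := `|G| + 1; have M0 : 0 < M by rewrite ltr_wpDl.
have eM : 0 < e / (2 * M) by rewrite divr_gt0 ?mulr_gt0.
have [d' d'0 hd'] := means_cauchy eM.
exists (Num.min d d') => [|k k0]; first by rewrite lt_min d0.
rewrite lt_min => /andP[kd kd'].
have [T hT] := hd k k0 kd; have [T' hT'] := hd' k k k0 kd' k0 kd'.
exists (Num.max T T') => t1 t2 Jt1 Jt2.
rewrite !ge_max lt_min => /andP[t1T t1T'] /andP[t2T t2T'] /andP[t12 t12'].
have le1 := hT _ _ Jt1 Jt2 t1T t2T t12.
have le2 := hT' _ _ Jt1 Jt2 t1T' t2T' t12'.
set p1 := Mean k W t1 in le1 le2 *; set p2 := Mean k W t2 in le2 *.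
have -> : gamma t2 *: (W t1 - p1) - gamma t1 *: (W t2 - p2) =
    (gamma t2 *: (W t1 - p1) - gamma t1 *: (W t2 - p1)) + gamma t1 *: (p2 - p1).
  rewrite -addrA; congr (_ + _); rewrite -!(scalerN (gamma t1)) -scalerDr.
  by congr (_ *: _); rewrite !opprB [RHS]addrC addrA subrK.
apply: le_lt_trans (rnormD _ _) _; rewrite rnormZ.
have GM : rnorm (gamma t1) <= M.
  by have := gamma_le Jt1; have := ler_norm G; rewrite /M; lra.
have : rnorm (gamma t1) * rnorm (p2 - p1) < e / 2.
  have -> : e / 2 = M * (e / (2 * M)) by field; rewrite gt_eqF.
  apply: (@le_lt_trans _ _ (M * rnorm (p2 - p1))).
    by apply: ler_wpM2r; [exact: rnorm_ge0|].
  by rewrite ltr_pM2l.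
lra.
Qed.

(** The first component is glued from the means [Mean k W] as [k] tends to [0]; the
    second one is the quotient of the remainder by [gamma]. *)
Lemma reconstruction :
  sum_class J (BUC J : set (R -> X)) (mul_class J gamma (BUC J : set (R -> X))) W.
Proof.
pose k n : R := n.+1%:R^-1.
have k0 n : 0 < k n by rewrite invr_gt0.
have k_small (d : R) : 0 < d -> exists N, forall n, (N <= n)%N -> k n < d.
  move=> d0; exists (Num.truncn d^-1) => n Nn; rewrite /k invf_plt ?posrE//.
  by apply: lt_le_trans (truncnS_gt _) _; rewrite ler_nat ltnS.
have p_luc n : luc J (Mean (k n) W).
  by apply: luc_Mean => //; exact: complete_sequentially.
have [|u [u_luc [C u_le] u_p]]
  := glue_at_infinity p_luc (fun n t Jt => Mean_W_le Jt (k0 n)).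
  move=> e /means_cauchy[d d0 hd]; have [N hN] := k_small d d0.
  exists N => m n Nm Nn.
  have [T hT] := hd (k n) (k m) (k0 n) (hN n Nn) (k0 m) (hN m Nm).
  by exists T => t Jt tT; apply: hT => //; rewrite subrr normr0.
have gamma_neq0 t : J t -> gamma t != 0.
  by move=> Jt; rewrite -rnorm_eq0 gt_eqF// (lt_le_trans c0)// gamma_ge.
pose v t : X := (gamma t)^-1 *: (W t - u t).
have u_uc : unif_continuous_on J u.
  apply: luc_uc u_luc _ => e e0; have e3 : 0 < e / 3 by rewrite divr_gt0.
  have [N hN] := u_p _ e3; have [d d0 hd] := means_cauchy e3.
  have [N' hN'] := k_small d d0; pose n := maxn N N'.
  have [T hT] := hN n (leq_maxl _ _).
  have kn := hN' n (leq_maxr _ _).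
  have [T' hT'] := hd (k n) (k n) (k0 n) kn (k0 n) kn.
  exists d => //; exists (Num.max T T') => s t Js Jt.
  rewrite !ge_max => /andP[sT sT'] /andP[tT tT'] st.
  have := hT s Js sT; have := hT t Jt tT.
  have := hT' t s Jt Js tT' sT'; rewrite distrC => /(_ st).
  have := rnorm_triangle (Mean (k n) W s) (u s) (u t).
  have := rnorm_triangle (Mean (k n) W t) (Mean (k n) W s) (u t).
  by rewrite (rnormBC (Mean (k n) W t) (u t)); lra.
have v_uc : unif_continuous_on J v.
  have v_luc : luc J v.
    move=> T; apply: (@uc_scale _ _ _ (fun t => (gamma t)^-1) _ c^-1 (B + C)).
    - move=> t [Jt _]; rewrite rnormV lef_pV2 ?posrE ?gamma_ge//.
      exact: lt_le_trans c0 (gamma_ge Jt).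
    - move=> t [Jt _]; apply: le_trans (rnormB _ _) _.
      by rewrite lerD// ?W_le// u_le.
    - by apply: uc_inv c0 _ (gamma_luc T) => t [Jt _]; exact: gamma_ge.
    - apply: ucD (W_luc T) _ => e e0; have [d d0 hd] := u_luc T e e0.
      by exists d => // s t Ss St st; rewrite -opprD rnormN; exact: hd.
  apply: luc_uc v_luc _ => e e0.
  have e2 : 0 < e * (c * c) / 2 by rewrite divr_gt0// !mulr_gt0.
  have [d d0 hd] := remainders_cauchy e2; have [N' hN'] := k_small d d0.
  pose M := `|G| + 1; have M0 : 0 < M by rewrite ltr_wpDl.
  have eM : 0 < e * (c * c) / (4 * M) by rewrite divr_gt0 ?mulr_gt0.
  have [N hN] := u_p _ eM; pose n := maxn N N'.
  have [T hT] := hN n (leq_maxl _ _).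
  have [T' hT'] := hd (k n) (k0 n) (hN' n (leq_maxr _ _)).
  exists d => //; exists (Num.max T T') => s t Js Jt.
  rewrite !ge_max => /andP[sT sT'] /andP[tT tT'] st.
  have := hT s Js sT; have := hT t Jt tT; have := hT' s t Js Jt sT' tT' st.
  set ps := Mean _ _ s; set pt := Mean _ _ t => le0 le_t le_s.
  have vE : v s - v t = ((gamma s)^-1 * (gamma t)^-1) *:
      ((gamma t *: (W s - ps) - gamma s *: (W t - pt))
       - gamma t *: (u s - ps) + gamma s *: (u t - pt)).
    have -> : (gamma t *: (W s - ps) - gamma s *: (W t - pt))
       - gamma t *: (u s - ps) + gamma s *: (u t - pt) =
       gamma t *: (W s - u s) - gamma s *: (W t - u t).
      rewrite !scalerBr !opprB !addrA [LHS](ACl (1*6*7*4*(5*2)*(3*8))) /=.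
      by rewrite !subrr !addr0.
    rewrite [RHS]scalerBr; congr (_ - _); rewrite scalerA /v.
      by rewrite -mulrA mulVf ?gamma_neq0// mulr1.
    by rewrite mulrAC mulVf ?gamma_neq0// mul1r.
  rewrite vE rnormZ rnormM !rnormV -invfM mulrC ltr_pdivrMr; last first.
    by rewrite mulr_gt0// (lt_le_trans c0)// gamma_ge.
  apply: (@lt_le_trans _ _ (e * (c * c))); last first.
    apply: ler_wpM2l; first exact: ltW.
    by apply: ler_pM; [exact: ltW|exact: ltW|exact: gamma_ge|exact: gamma_ge].
  have GM r : J r -> rnorm (gamma r) <= M.
    by move=> Jr; have := gamma_le Jr; have := ler_norm G; rewrite /M; lra.
  have half r y : J r -> rnorm y < e * (c * c) / (4 * M) ->
      rnorm (gamma r *: (y : X)) <= e * (c * c) / 4.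
    move=> Jr /ltW yM; rewrite rnormZ.
    have -> : e * (c * c) / 4 = M * (e * (c * c) / (4 * M)) by field; rewrite gt_eqF.
    by apply: ler_pM; rewrite ?rnorm_ge0// GM.
  apply: le_lt_trans (rnormD _ _) _.
  have := rnormB (gamma t *: (W s - ps) - gamma s *: (W t - pt)) (gamma t *: (u s - ps)).
  by have := half _ _ Jt le_s; have := half _ _ Js le_t; lra.
exists u, (fun t => gamma t *: v t); split.
- by split=> //; apply/boundedP; exists C.
- exists v => //; split=> //; apply/boundedP; exists (c^-1 * (B + C)) => t Jt.
  rewrite rnormZ rnormV; apply: ler_pM; rewrite ?invr_ge0 ?rnorm_ge0//.
    by rewrite lef_pV2 ?posrE ?gamma_ge// (lt_le_trans c0 (gamma_ge Jt)).
  by apply: le_trans (rnormB _ _) _; rewrite lerD ?W_le ?u_le.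
- move=> t Jt; rewrite /v scalerA mulfV ?gamma_neq0// scale1r.
  by rewrite addrC subrK.
Qed.

End Reconstruction.

(** * Members of the sum class *)

Section Determinants.
Context {R : realType} {Y : normedModType R[i]}.
Implicit Types (w : R -> Y) (t : R) (c : R[i]^o).

Lemma rnorm_lin3 w c1 c2 c3 t1 t2 t3 : rnorm (lin3 w c1 c2 c3 t1 t2 t3) <=
  rnorm c1 * rnorm (w t1) + rnorm c2 * rnorm (w t2) + rnorm c3 * rnorm (w t3).
Proof.
rewrite -!rnormZ; apply: le_trans (rnormD _ _) _; apply: lerD => //.
exact: rnormD.
Qed.

Lemma lin3B w w' c1 c2 c3 t1 t2 t3 :
  lin3 (fun t => w t - w' t) c1 c2 c3 t1 t2 t3 =
  lin3 w c1 c2 c3 t1 t2 t3 - lin3 w' c1 c2 c3 t1 t2 t3.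
Proof. by rewrite /lin3 !scalerBr !opprD !addrA [LHS](ACl (1*3*5*2*4*6)). Qed.

Lemma lin3BZ w a c1 c2 c3 c1' c2' c3' t1 t2 t3 :
  lin3 w (c1 - a * c1') (c2 - a * c2') (c3 - a * c3') t1 t2 t3 =
  lin3 w c1 c2 c3 t1 t2 t3 - a *: lin3 w c1' c2' c3' t1 t2 t3.
Proof.
rewrite /lin3 !scalerBl !scalerDr !scalerA !opprD !addrA.
by rewrite [LHS](ACl (1*3*5*2*4*6)).
Qed.

Lemma det_affine (gamma : R -> R[i]^o) (x y : Y) t1 t2 t3 :
  det gamma (fun t => x + gamma t *: y) t1 t2 t3 = 0.
Proof.
rewrite /det /lin3 !scalerDr !scalerA !addrA.
rewrite [LHS](ACl ((1*3*5)*(2*4*6))) /= -!scalerDl.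
set a := (X in X *: x); set b := (X in X *: y).
have -> : a = 0 by rewrite /a; ring.
have -> : b = 0 by rewrite /b; ring.
by rewrite !scale0r addr0.
Qed.

Lemma is_mean_lin3 (g : R -> R -> Y) (w : R -> Y) h c1 c2 c3 t1 t2 t3 :
  is_mean h (g t1) (w t1) -> is_mean h (g t2) (w t2) -> is_mean h (g t3) (w t3) ->
  is_mean h (fun s => lin3 (g^~ s) c1 c2 c3 t1 t2 t3) (lin3 w c1 c2 c3 t1 t2 t3).
Proof.
by move=> m1 m2 m3; apply: is_meanD; first apply: is_meanD; exact: is_meanZ.
Qed.

Lemma Delta_split (f : R -> Y) (y b t : R) :
  Delta b f (t + y) = Delta (y + b) f t - Delta y f t.
Proof. by rewrite /Delta opprB addrA subrK addrA. Qed.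

End Determinants.

Section SumClass.
Context {R : realType} {X : normedModType R[i]}.
Variables (J : set R) (gamma : R -> R[i]^o) (G : R).
Hypothesis gamma_le : forall t, J t -> rnorm (gamma t) <= G.
Hypothesis gamma_luc : luc J gamma.
Variable w : R -> X.
Hypothesis w_sum :
  sum_class J (BUC J : set (R -> X)) (mul_class J gamma (BUC J : set (R -> X))) w.

Lemma sum_class_luc_bounded : luc J w /\ exists M : R, forall t, J t -> rnorm (w t) <= M.
Proof.
have [u [gv [[uu /boundedP[B uB]] [v [vu /boundedP[C vC]] gvE] wE]]] := w_sum.
have wE' t : J t -> w t = u t + gamma t *: v t by move=> Jt; rewrite wE// gvE.
split=> [T|].
  apply: (@eq_uc _ _ _ (fun t => u t + gamma t *: v t)) => [t [Jt _]|].
    by rewrite wE'.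
  apply: ucD; first by apply: ucS uu => t [].
  apply: (@uc_scale _ _ _ _ _ G C) => //.
  - by move=> t [Jt _]; exact: gamma_le.
  - by move=> t [Jt _]; exact: vC.
  - by apply: ucS vu => t [].
exists (B + G * C) => t Jt; rewrite wE'//; apply: le_trans (rnormD _ _) _.
by rewrite rnormZ lerD ?uB// ler_pM ?rnorm_ge0 ?vC ?gamma_le.
Qed.

(** Near [t1] the function [w] is close to an affine function of [gamma], and the
    determinant kills these. *)
Lemma sum_class_det (e : R) : 0 < e -> exists2 d : R, 0 < d &
  forall t1 t2 t3, J t1 -> J t2 -> J t3 -> `|t1 - t2| < d -> `|t1 - t3| < d ->
    rnorm (det gamma w t1 t2 t3) <= e.
Proof.
have [u [gv [[uu _] [v [vu _] gvE] wE]]] := w_sum.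
have wE' t : J t -> w t = u t + gamma t *: v t by move=> Jt; rewrite wE// gvE.
move=> e0; pose K := `|G| + 1; have K0 : 0 < K by rewrite ltr_wpDl.
have GK t : J t -> rnorm (gamma t) <= K.
  by move=> Jt; have := gamma_le Jt; have := ler_norm G; rewrite /K; lra.
pose r := e / (4 * K * (1 + K)).
have r0 : 0 < r by rewrite divr_gt0// !mulr_gt0// addr_gt0.
have [d d0 hd] := uu _ r0; have [d' d'0 hd'] := vu _ r0.
exists (Num.min d d'); first by rewrite lt_min d0.
move=> t1 t2 t3 Jt1 Jt2 Jt3; rewrite !lt_min => /andP[t12 t12'] /andP[t13 t13'].
pose z t := w t - (u t1 + gamma t *: v t1).
have -> : det gamma w t1 t2 t3 = det gamma z t1 t2 t3.
  have -> : det gamma z t1 t2 t3 = det gamma w t1 t2 t3 -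
      det gamma (fun t => u t1 + gamma t *: v t1) t1 t2 t3 by exact: lin3B.
  by rewrite det_affine subr0.
have zE t : J t -> z t = (u t - u t1) + gamma t *: (v t - v t1).
  by move=> Jt; rewrite /z wE'// scalerBr opprD addrACA.
have z_le t : J t -> `|t1 - t| < d -> `|t1 - t| < d' -> rnorm (z t) <= r * (1 + K).
  move=> Jt tt tt'; rewrite zE//; apply: le_trans (rnormD _ _) _.
  rewrite mulrDr mulr1 rnormZ; apply: lerD; first by rewrite rnormBC ltW// hd.
  by rewrite mulrC ler_pM ?rnorm_ge0 ?GK// rnormBC ltW// hd'.
have z1 : rnorm (z t1) = 0 by rewrite zE// !subrr scaler0 addr0 rnorm0.
have coef t t' : J t -> J t' -> rnorm (gamma t - gamma t' : R[i]^o) <= 2 * K.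
  by move=> Jt Jt'; have := rnormB (gamma t) (gamma t'); have := GK t Jt;
    have := GK t' Jt'; lra.
apply: le_trans (rnorm_lin3 _ _ _ _ _ _ _) _; rewrite z1 mulr0 add0r.
have -> : e = 2 * K * (r * (1 + K)) + 2 * K * (r * (1 + K)).
  by rewrite /r; field; rewrite !gt_eqF// addr_gt0.
by apply: lerD; apply: ler_pM; rewrite ?rnorm_ge0 ?coef ?z_le.
Qed.

End SumClass.

(** * Quotients of translates *)

Section Quotients.
Context {R : realType}.
Variables (J : set R) (J_adm : admissible_interval J).
Variables (gamma : R -> R[i]^o) (c G : R).
Hypothesis c0 : 0 < c.
Hypothesis gamma_ge : forall t, J t -> c <= rnorm (gamma t).
Hypothesis gamma_le : forall t, J t -> rnorm (gamma t) <= G.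
Hypothesis gamma_cont : {within J, continuous gamma}.
Hypothesis gamma_quot : exists2 eps0 : R, 0 < eps0 & forall a : R, 0 < a -> a < eps0 ->
  unif_continuous_on J (fun t => gamma (t + a) / gamma t : R[i]^o).

Let J_up := @admissible_up R J J_adm.

Lemma gamma_neq0 t : J t -> gamma t != 0.
Proof.
by move=> Jt; rewrite -rnorm_eq0 gt_eqF// (lt_le_trans c0)// gamma_ge.
Qed.

Lemma quotient_le t a : J t -> 0 <= a -> rnorm (gamma (t + a) / gamma t) <= G / c.
Proof.
move=> Jt a0; rewrite rnormM rnormV; apply: ler_pM; rewrite ?invr_ge0 ?rnorm_ge0//.
  by apply: gamma_le; exact: J_up.
by rewrite lef_pV2 ?posrE ?gamma_ge// (lt_le_trans c0 (gamma_ge Jt)).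
Qed.

(** Large translations are reached in small steps, by the cocycle identity of
    the quotients. *)
Lemma quotient_uc (a : R) : 0 < a ->
  unif_continuous_on J (fun t => gamma (t + a) / gamma t : R[i]^o).
Proof.
move=> a0; have [eps eps0 hq] := gamma_quot.
pose n := (Num.truncn (a / eps)).+1; have n0 : 0 < n%:R :> R by rewrite ltr0n.
pose b := a / n%:R; have b0 : 0 < b by rewrite divr_gt0.
have b_eps : b < eps.
  by rewrite ltr_pdivrMr// mulrC -ltr_pdivrMr//; exact: truncnS_gt.
have -> : a = n%:R * b by rewrite /b mulrC divfK// gt_eqF.
elim: (n) => [|k IH].
  move=> e e0; exists 1 => // s t Js Jt _.
  by rewrite mul0r !addr0 !mulfV ?gamma_neq0// subrr rnorm0.
have kb0 : 0 <= k%:R * b by rewrite mulr_ge0// ltW.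
apply: (@eq_uc _ _ _ (fun t => (gamma (t + b + k%:R * b) / gamma (t + b) : R[i]^o) *:
    (gamma (t + b) / gamma t : R[i]^o))) => [t Jt|].
  have -> : t + k.+1%:R * b = t + b + k%:R * b by rewrite -natr1; ring.
  rewrite /GRing.scale /= mulrA divfK//; apply: gamma_neq0; apply: J_up => //.
  exact: ltW.
apply: (@uc_scale _ _ _ _ _ (G / c) (G / c)).
- by move=> t Jt; apply: quotient_le => //; apply: J_up => //; exact: ltW.
- by move=> t Jt; apply: quotient_le => //; exact: ltW.
- apply: (uc_shift (S' := J) (w := fun t => gamma (t + k%:R * b) / gamma t : R[i]^o)) IH.
  by move=> t Jt; apply: J_up => //; exact: ltW.
- exact: hq.
Qed.

(** On a bounded window, the translate of [gamma] by [1] only takes values from a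
    compact segment in [J], and [gamma] is its product with the inverse of a uniformly
    continuous quotient. *)
Lemma gamma_luc_of_quotients : luc J gamma.
Proof.
move=> T.
have [p [q [pqJ pq]]] := admissible_window J_adm T (@ltr01 R).
have J1 t : J t -> J (t + 1) by move=> Jt; apply: J_up.
have quot_ge t : J t -> c / G <= rnorm (gamma (t + 1) / gamma t).
  move=> Jt; have G0 : 0 < rnorm (gamma t) by exact: lt_le_trans c0 (gamma_ge Jt).
  rewrite rnormM rnormV; apply: ler_pM.
  - exact: ltW.
  - by rewrite invr_ge0 (le_trans (rnorm_ge0 _) (gamma_le Jt)).
  - by apply: gamma_ge; exact: J1.
  - by rewrite lef_pV2 ?posrE ?gamma_le// (lt_le_trans G0 (gamma_le Jt)).
have [[t0 Jt0]|J0] := pselect (exists t, J t); last first.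
  by move=> e e0; exists 1 => // s t [Js]; case: J0; exists s.
have G0 : 0 < G.
  exact: lt_le_trans (lt_le_trans c0 (gamma_ge Jt0)) (gamma_le Jt0).
apply: (@eq_uc _ _ _ (fun t => ((gamma (t + 1) / gamma t)^-1 : R[i]^o) *:
    (gamma (t + 1) : R[i]^o))) => [t [Jt _]|].
  have g1 := gamma_neq0 (J1 t Jt).
  rewrite -[LHS]/((gamma (t + 1) / gamma t)^-1 * gamma (t + 1)).
  by rewrite invfM invrK mulrC mulrA mulfV// mul1r.
apply: (@uc_scale _ _ _ _ _ (c / G)^-1 G).
- move=> t [Jt _]; rewrite rnormV lef_pV2 ?posrE ?quot_ge ?divr_gt0//.
  by apply: lt_le_trans (quot_ge t Jt); rewrite divr_gt0.
- by move=> t [Jt _]; apply: gamma_le; exact: J1.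
- apply: (@uc_inv _ _ _ (c / G)); first by rewrite divr_gt0.
    by move=> t [Jt _]; exact: quot_ge.
  by apply: ucS (quotient_uc ltr01) => t [].
move=> e e0; have [d d0 hd] := heine_cantor gamma_cont pqJ e0.
exists d => // s t [Js /= sT] [Jt /= tT] st; apply: hd.
- exact: pq.
- exact: pq.
- by rewrite opprD addrACA subrr addr0.
Qed.

End Quotients.

Section RightOpen.
Context {R : realType}.
Implicit Types (t : R) (u : nat -> R).

Lemma right_seq_up (J : set R) t u : (forall t a : R, J t -> 0 <= a -> J (t + a)) ->
  J t -> right_seq t u -> forall n, J (u n).
Proof.
move=> Jup Jt [tu _] n; rewrite -(subrK t (u n)) addrC.
by apply: Jup => //; rewrite subr_ge0 ltW.
Qed.

Lemma right_seq_near_dist t t' u u' (d : R) : right_seq t u -> right_seq t' u' ->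
  `|t - t'| < d -> \forall n \near \oo, `|u n - u' n| < d.
Proof.
move=> [_ ut] [_ ut'] tt'; have : `|u n - u' n| @[n --> \oo] --> `|t - t'|.
  by apply: cvg_norm; exact: cvgB.
by move=> norm_ut; exact: (cvgr_lt _ norm_ut _ tt').
Qed.

Lemma right_seq_near_norm t u (T : R) : right_seq t u -> `|t| < T ->
  \forall n \near \oo, `|u n| < T.
Proof.
move=> [_ ut] tT; have norm_ut : `|u n| @[n --> \oo] --> `|t| by exact: cvg_norm.
exact: (cvgr_lt _ norm_ut _ tT).
Qed.

End RightOpen.

(** * Uniform control of the increments *)

Section Uniformization.
Context {R : realType} {X : completeNormedModType R[i]}.
Variables (J : set R) (J_adm : admissible_interval J).
Variables (gamma : R -> R[i]^o) (c G : R).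
Hypothesis c0 : 0 < c.
Hypothesis gamma_ge : forall t, J t -> c <= rnorm (gamma t).
Hypothesis gamma_le : forall t, J t -> rnorm (gamma t) <= G.
Hypothesis gamma_luc : luc J gamma.
Hypothesis gamma_quot : forall a : R, 0 < a ->
  unif_continuous_on J (fun t => gamma (t + a) / gamma t : R[i]^o).
Variable f : R -> X.
Hypothesis f_L1 : L1loc J f.
Hypothesis f_Delta : forall a : R, 0 < a ->
  sum_class J (BUC J : set (R -> X)) (mul_class J gamma (BUC J : set (R -> X)))
    (Delta a f).

Let J_up := @admissible_up R J J_adm.

Let Delta_luc a (a0 : 0 < a) : luc J (Delta a f) :=
  (sum_class_luc_bounded gamma_le gamma_luc (f_Delta a0)).1.

Let Delta_bounded a (a0 : 0 < a) :
    exists M : R, forall t, J t -> rnorm (Delta a f t) <= M :=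
  (sum_class_luc_bounded gamma_le gamma_luc (f_Delta a0)).2.

Let Delta_right a t u (a0 : 0 < a) (Jt : J t) (tu : right_seq t u) :
  Delta a f (u n) @[n --> \oo] --> Delta a f t :=
  luc_right_cvg J_up (Delta_luc a0) Jt tu.

Let gamma_right t u (Jt : J t) (tu : right_seq t u) :
  gamma (u n) @[n --> \oo] --> gamma t := luc_right_cvg J_up gamma_luc Jt tu.

Let pred_J H y t : J (t - H) -> 0 <= H -> y <= H -> J (t - y).
Proof.
move=> JtH H0 yH; have -> : t - y = t - H + (H - y) by ring.
by apply: J_up => //; rewrite subr_ge0.
Qed.

Let invS_lt (m n : nat) : (m <= n)%N -> (n.+1%:R^-1 : R) <= m.+1%:R^-1.
Proof. by move=> mn; rewrite lef_pV2 ?posrE// ler_nat. Qed.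

Let invS_small (d : R) : 0 < d -> exists n : nat, (n.+1%:R^-1 : R) < d.
Proof.
by move=> d0; exists (Num.truncn d^-1); rewrite invf_plt ?posrE//; exact: truncnS_gt.
Qed.

(** The tests bound [Delta a f] by [n]; the quantity [4 * h] leaves room for all
    [b <= h] in the Steinhaus argument. Shifting by [y <= 4 * h] costs the part of
    [J] close to its left endpoint. *)
Lemma Delta_uniformly_bounded (h : R) : 0 < h -> exists M : R, forall b t : R,
  0 <= b <= h -> J (t - 4 * h) -> rnorm (Delta b f t) <= M.
Proof.
move=> h0; have H0 : 0 < 4 * h by rewrite mulr_gt0.
pose E (n : nat) := [set a | 0 <= a <= 4 * h /\ forall t1 t2 t3 : R,
  [/\ J t1, J t2 & J t3] -> rnorm (lin3 (Delta a f) 1 0 0 t1 t2 t3) <= n%:R].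
have [n|m n mn a [aH Ea]|a /andP[a0 aH]|n hn] := @steinhaus_uniform R (4 * h) E H0.
- apply: (@ae_measurable_tests _ _ J f (4 * h) J_up f_L1
    (fun t1 t2 t3 => [/\ J t1, J t2 & J t3]) n%:R
    (fun _ _ _ => 1) (fun _ _ _ => 0) (fun _ _ _ => 0)) => //.
  move=> t1 t2 t3 u1 u2 u3 [Jt1 Jt2 Jt3] tu1 tu2 tu3; split; try exact: cvg_cst.
  by apply: nearW => k; split; [exact: (right_seq_up J_up Jt1 tu1)|
    exact: (right_seq_up J_up Jt2 tu2)|exact: (right_seq_up J_up Jt3 tu3)].
- split=> // t1 t2 t3 Jt; apply: le_trans (Ea _ _ _ Jt) _; by rewrite ler_nat.
- have [M hM] := Delta_bounded a0; exists (Num.truncn M).+1; split=> [|t1 t2 t3 [Jt _ _]].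
    by rewrite ltW.
  rewrite /lin3 scale1r !scale0r !addr0; apply: le_trans (hM _ Jt) _.
  exact/ltW/truncnS_gt.
exists (n%:R + n%:R) => b t bh Jt.
have [|y [y0 ybH [_ Ey] [_ Eyb]]] := hn b.
  by have -> : 4 * h / 4 = h by field.
have Jty : J (t - y).
  by apply: pred_J Jt _ _; [exact: ltW|have /andP[] := bh; lra].
have := Ey _ _ _ (And3 Jty Jty Jty); have := Eyb _ _ _ (And3 Jty Jty Jty).
rewrite /lin3 !scale1r !scale0r !addr0 => le1 le2.
rewrite -(subrK y t) Delta_split; apply: le_trans (rnormB _ _) _.
exact: lerD.
Qed.

Lemma Delta_equi_luc (h T e : R) : 0 < h -> 0 < e -> exists2 d : R, 0 < d &
  forall b s t : R, 0 <= b <= h -> J (s - 4 * h) -> J (t - 4 * h) ->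
  `|s| <= T -> `|t| <= T -> `|s - t| < d -> rnorm (Delta b f s - Delta b f t) <= e.
Proof.
move=> h0 e0; have H0 : 0 < 4 * h by rewrite mulr_gt0.
have e2 : 0 < e / 2 by rewrite divr_gt0.
pose T' := `|T| + 4 * h + 1.
pose Om (n : nat) (t1 t2 t3 : R) :=
  [/\ J t1, J t2 & J t3] /\ [/\ `|t1| < T', `|t2| < T' & `|t1 - t2| < n.+1%:R^-1].
pose E (n : nat) := [set a | 0 <= a <= 4 * h /\ forall t1 t2 t3 : R, Om n t1 t2 t3 ->
  rnorm (lin3 (Delta a f) 1 (-1) 0 t1 t2 t3) <= e / 2].
have linE w t1 t2 t3 : lin3 w 1 (-1) 0 t1 t2 t3 = w t1 - w t2 :> X.
  by rewrite /lin3 scale1r scaleN1r scale0r addr0.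
have [n|m n mn a [aH Ea]|a /andP[a0 aH]|n hn] := @steinhaus_uniform R (4 * h) E H0.
- apply: (@ae_measurable_tests _ _ J f (4 * h) J_up f_L1 (Om n) (e / 2)
    (fun _ _ _ => 1) (fun _ _ _ => -1) (fun _ _ _ => 0)) => //.
    by move=> t1 t2 t3 [].
  move=> t1 t2 t3 u1 u2 u3 [[Jt1 Jt2 Jt3] [t1T t2T t12]] tu1 tu2 tu3.
  split; try exact: cvg_cst.
  have n1 := right_seq_near_norm tu1 t1T; have n2 := right_seq_near_norm tu2 t2T.
  have n12 := right_seq_near_dist tu1 tu2 t12.
  apply: filterS3 n1 n2 n12 => k k1 k2 k12.
  split; split=> //; [exact: (right_seq_up J_up Jt1 tu1)|
    exact: (right_seq_up J_up Jt2 tu2)|exact: (right_seq_up J_up Jt3 tu3)].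
- split=> // t1 t2 t3 [Jt [t1T t2T t12]]; apply: Ea; split=> //; split=> //.
  exact: lt_le_trans t12 (invS_lt mn).
- have [d d0 hd] := Delta_luc a0 T' e2; have [n nd] := invS_small d0.
  exists n; split=> [|t1 t2 t3 [[Jt1 Jt2 _] [t1T t2T t12]]]; first by rewrite ltW.
  rewrite linE; apply/ltW/hd; [by split=> //=; exact: ltW|by split=> //=; exact: ltW|].
  exact: lt_trans t12 nd.
exists n.+1%:R^-1; first by rewrite invr_gt0.
move=> b s t bh Js Jt sT tT st.
have [|y [y0 ybH [_ Ey] [_ Eyb]]] := hn b.
  by have -> : 4 * h / 4 = h by field.
have yH : y <= 4 * h by have /andP[] := bh; lra.
have Jsy : J (s - y) by apply: pred_J Js _ yH; exact: ltW.
have Jty : J (t - y) by apply: pred_J Jt _ yH; exact: ltW.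
have T'_ge r : `|r| <= T -> `|r - y| < T'.
  move=> rT; have := ler_normB r y; rewrite (gtr0_norm y0).
  by have := ler_norm T; rewrite /T'; lra.
have Omst : Om n (s - y) (t - y) (t - y).
  split=> //; split; [exact: T'_ge|exact: T'_ge|].
  by rewrite opprB addrA subrK.
have := Ey _ _ _ Omst; have := Eyb _ _ _ Omst; rewrite !linE => le1 le2.
rewrite -(subrK y s) -(subrK y t) !(Delta_split f y b) [e]splitr.
have subACA (x x' z z' : X) : x - x' - (z - z') = (x - z) - (x' - z').
  by rewrite !opprB !addrA [LHS](ACl (1*4*3*2)).
rewrite subACA; apply: le_trans (rnormB _ _) _; exact: lerD.
Qed.

Let gamma_neq0J t (Jt : J t) : gamma t != 0 := gamma_neq0 c0 gamma_ge Jt.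

Let inv_luc : luc J (fun t => (gamma t)^-1 : R[i]^o).
Proof. by move=> T; apply: uc_inv c0 _ (gamma_luc T) => t [Jt _]; exact: gamma_ge. Qed.

Let Delta_gamma_luc a : 0 < a -> luc J (Delta a gamma).
Proof.
move=> a0 T; apply: ucD.
  apply: (uc_shift (S' := J `&` [set t | `|t| <= T + a])) (gamma_luc _) => t [Jt /= tT].
  split=> /=; first by apply: J_up => //; exact: ltW.
  by apply: le_trans (ler_normD _ _) _; rewrite (gtr0_norm a0) lerD2r.
move=> e e0; have [d d0 hd] := gamma_luc T e0; exists d => // s t Ss St st.
by rewrite -opprD rnormN; exact: hd.
Qed.

(** The increment [Delta b f] at [t + y] is a difference of two increments at [t],
    so its determinants are controlled with weights [gamma t] instead of
    [gamma (t + y)]. Both are compared by means of the quotient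
    [gamma (t + y) / gamma t], which hardly varies from one of the three points to
    another, uniformly in the [y] that the Steinhaus argument provides. *)
Lemma Delta_equi_det (h e : R) : 0 < h -> 0 < e -> exists2 d : R, 0 < d &
  forall b t1 t2 t3 : R, 0 <= b <= h ->
  J (t1 - 4 * h) -> J (t2 - 4 * h) -> J (t3 - 4 * h) ->
  `|t1 - t2| < d -> `|t1 - t3| < d -> rnorm (det gamma (Delta b f) t1 t2 t3) <= e.
Proof.
move=> h0 e0; have H0 : 0 < 4 * h by rewrite mulr_gt0.
have [M0 hM0] := Delta_uniformly_bounded h0.
pose M := `|M0| + 1; have M_gt0 : 0 < M by rewrite ltr_wpDl.
pose K := `|G| + 1; have K_gt0 : 0 < K by rewrite ltr_wpDl.
have GK t : J t -> rnorm (gamma t) <= K.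
  by move=> Jt; have := gamma_le Jt; have := ler_norm G; rewrite /K; lra.
pose D := 2 * (K / c) + 12 * (K * M).
have D0 : 0 < D by rewrite addr_gt0// mulr_gt0// ?divr_gt0// mulr_gt0.
pose r := e / D; have r0 : 0 < r by rewrite divr_gt0.
pose Om (n : nat) (t1 t2 t3 : R) := [/\ J t1, J t2 & J t3] /\
  (`|t1 - t2| < n.+1%:R^-1 /\ `|t1 - t3| < n.+1%:R^-1).
have Om_mono m n t1 t2 t3 : (m <= n)%N -> Om n t1 t2 t3 -> Om m t1 t2 t3.
  by move=> mn [Jt [t12 t13]]; split=> //; split; apply: lt_le_trans (invS_lt mn).
have Om_right n t1 t2 t3 u1 u2 u3 : Om n t1 t2 t3 ->
    right_seq t1 u1 -> right_seq t2 u2 -> right_seq t3 u3 ->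
    \forall k \near \oo, Om n (u1 k) (u2 k) (u3 k).
  move=> [[Jt1 Jt2 Jt3] [t12 t13]] tu1 tu2 tu3.
  have n12 := right_seq_near_dist tu1 tu2 t12.
  have n13 := right_seq_near_dist tu1 tu3 t13.
  apply: filterS2 n12 n13 => k k12 k13; split=> //.
  split; [exact: (right_seq_up J_up Jt1 tu1)|
    exact: (right_seq_up J_up Jt2 tu2)|exact: (right_seq_up J_up Jt3 tu3)].
pose E1 (n : nat) := [set a | 0 <= a <= 4 * h /\ forall t1 t2 t3 : R, Om n t1 t2 t3 ->
  rnorm (lin3 (Delta a f) (gamma t2 - gamma t3) (gamma t3 - gamma t1)
    (gamma t1 - gamma t2) t1 t2 t3) <= r].
pose E2 (n : nat) := [set a | 0 <= a <= 4 * h /\ forall t1 t2 t3 : R, Om n t1 t2 t3 ->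
  rnorm (lin3 (Delta a gamma) (gamma t1)^-1 (- (gamma t2)^-1) 0 t1 t2 t3) <= r].
have quotE a t1 t2 t3 : J t1 -> J t2 ->
    lin3 (Delta a gamma) (gamma t1)^-1 (- (gamma t2)^-1) 0 t1 t2 t3 =
    gamma (t1 + a) / gamma t1 - gamma (t2 + a) / gamma t2.
  move=> Jt1 Jt2; rewrite /lin3 /Delta /GRing.scale /= mul0r addr0.
  by field; rewrite !gamma_neq0J.
pose E n := E1 n `&` E2 n.
have [n|m n mn a [[aH E1a] [_ E2a]]|a /andP[a0 aH]|n hn] :=
  @steinhaus_uniform R (4 * h) E H0.
- apply: ae_measurableI.
    apply: (@ae_measurable_tests _ _ J f (4 * h) J_up f_L1 (Om n) r
      (fun _ t2 t3 => gamma t2 - gamma t3) (fun t1 _ t3 => gamma t3 - gamma t1)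
      (fun t1 t2 _ => gamma t1 - gamma t2)) => //; first by move=> t1 t2 t3 [].
    move=> t1 t2 t3 u1 u2 u3 Omt tu1 tu2 tu3; have [[Jt1 Jt2 Jt3] _] := Omt.
    split; [exact: Om_right Omt tu1 tu2 tu3|apply: cvgB|apply: cvgB|apply: cvgB];
      exact: gamma_right.
  apply: (@ae_measurable_tests _ _ J gamma (4 * h) J_up (luc_L1loc gamma_luc) (Om n) r
    (fun t1 _ _ => (gamma t1)^-1) (fun _ t2 _ => - (gamma t2)^-1) (fun _ _ _ => 0)).
  + by move=> t1 t2 t3 [].
  + move=> t1 t2 t3 u1 u2 u3 Omt tu1 tu2 tu3; have [[Jt1 Jt2 Jt3] _] := Omt.
    split; [exact: Om_right Omt tu1 tu2 tu3| |apply: cvgN|exact: cvg_cst].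
      exact: (luc_right_cvg J_up inv_luc Jt1 tu1).
    exact: (luc_right_cvg J_up inv_luc Jt2 tu2).
  + move=> a t u a0 Jt tu; exact: (luc_right_cvg J_up (Delta_gamma_luc a0) Jt tu).
- split; split=> // t1 t2 t3 /(Om_mono _ _ _ _ _ mn); [exact: E1a|exact: E2a].
- have [d d0 hd] := sum_class_det gamma_le (f_Delta a0) r0.
  have [d' d'0 hd'] := gamma_quot a0 r0.
  have dd' : 0 < Num.min d d' by rewrite lt_min d0.
  have [n] := invS_small dd'; rewrite lt_min => /andP[nd nd'].
  exists n; split; (split; first by rewrite ltW);
    move=> t1 t2 t3 [[Jt1 Jt2 Jt3] [t12 t13]].
    by apply: hd => //; [exact: lt_trans t12 nd|exact: lt_trans t13 nd].
  by rewrite quotE//; apply/ltW/hd' => //; exact: lt_trans t12 nd'.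
exists n.+1%:R^-1; first by rewrite invr_gt0.
move=> b t1 t2 t3 bh J1 J2 J3 t12 t13.
have [|y [y0 ybH [[_ E1y] [_ E2y]] [[_ E1yb] _]]] := hn b.
  by have -> : 4 * h / 4 = h by field.
have yH : y <= 4 * h by have /andP[] := bh; lra.
have Jy t : J (t - 4 * h) -> J (t - y).
  by move=> Jt; apply: pred_J Jt _ yH; exact: ltW.
have sub_y s t : s - y - (t - y) = s - t by rewrite opprB addrA subrK.
have OmS a1 a2 a3 : J (a1 - 4 * h) -> J (a2 - 4 * h) -> J (a3 - 4 * h) ->
    `|a1 - a2| < n.+1%:R^-1 -> `|a1 - a3| < n.+1%:R^-1 ->
    Om n (a1 - y) (a2 - y) (a3 - y).
  by move=> Ja1 Ja2 Ja3 a12 a13; split; [split; exact: Jy|split; rewrite sub_y].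
have Omt := OmS _ _ _ J1 J2 J3 t12 t13.
pose q t : R[i]^o := gamma t / gamma (t - y).
have q1q t : J (t - 4 * h) -> `|t1 - t| < n.+1%:R^-1 -> rnorm (q t1 - q t) <= r.
  move=> Jt t1t; have := E2y _ _ _ (OmS _ _ _ J1 Jt Jt t1t t1t).
  by rewrite quotE ?subrK//; exact: Jy.
have gq t : J (t - 4 * h) -> gamma t = q t * gamma (t - y).
  by move=> Jt; rewrite /q divfK// gamma_neq0J//; exact: Jy.
have q1_le : rnorm (q t1) <= K / c.
  rewrite /q rnormM rnormV; apply: ler_pM; rewrite ?invr_ge0 ?rnorm_ge0//.
    by apply: GK; rewrite -(subrK (4 * h) t1); apply: J_up => //; exact: ltW.
  by rewrite lef_pV2 ?posrE ?gamma_ge ?(lt_le_trans c0 (gamma_ge _))//; exact: Jy.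
pose g' t := gamma (t - y).
have coef s t : J (s - 4 * h) -> J (t - 4 * h) -> `|t1 - s| < n.+1%:R^-1 ->
    `|t1 - t| < n.+1%:R^-1 ->
    rnorm (gamma s - gamma t - q t1 * (g' s - g' t) : R[i]^o) <= 2 * (r * K).
  move=> Js Jt t1s t1t; rewrite (gq _ Js) (gq _ Jt) /g'.
  have -> : q s * gamma (s - y) - q t * gamma (t - y) -
      q t1 * (gamma (s - y) - gamma (t - y)) =
      (q t1 - q t) * gamma (t - y) - (q t1 - q s) * gamma (s - y) :> R[i]^o by ring.
  apply: le_trans (rnormB _ _) _; rewrite !rnormM.
  have h1 : rnorm (q t1 - q t) * rnorm (gamma (t - y)) <= r * K.
    by apply: ler_pM; rewrite ?rnorm_ge0 ?q1q// GK//; exact: Jy.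
  have h2 : rnorm (q t1 - q s) * rnorm (gamma (s - y)) <= r * K.
    by apply: ler_pM; rewrite ?rnorm_ge0 ?q1q// GK//; exact: Jy.
  lra.
have w_le t : J (t - 4 * h) -> rnorm (Delta b f t) <= M.
  by move=> Jt; have := hM0 b t bh Jt; have := ler_norm M0; rewrite /M; lra.
have t11 : `|t1 - t1| < n.+1%:R^-1 by rewrite subrr normr0 invr_gt0.
set P := lin3 (Delta b f) (g' t2 - g' t3) (g' t3 - g' t1) (g' t1 - g' t2) t1 t2 t3.
have P_le : rnorm P <= r + r.
  have -> : P = lin3 (Delta (y + b) f) (g' t2 - g' t3) (g' t3 - g' t1) (g' t1 - g' t2)
      (t1 - y) (t2 - y) (t3 - y) - lin3 (Delta y f) (g' t2 - g' t3) (g' t3 - g' t1)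
      (g' t1 - g' t2) (t1 - y) (t2 - y) (t3 - y).
    by rewrite -lin3B /lin3 -!(Delta_split f y b) !subrK.
  by apply: le_trans (rnormB _ _) _; apply: lerD; [exact: E1yb|exact: E1y].
set Q := det gamma (Delta b f) t1 t2 t3.
have Q_P : rnorm (Q - q t1 *: P) <= 12 * (r * (K * M)).
  rewrite -lin3BZ; apply: le_trans (rnorm_lin3 _ _ _ _ _ _ _) _.
  have bnd s t x : J (s - 4 * h) -> J (t - 4 * h) -> J (x - 4 * h) ->
      `|t1 - s| < n.+1%:R^-1 -> `|t1 - t| < n.+1%:R^-1 ->
      rnorm (gamma s - gamma t - q t1 * (g' s - g' t) : R[i]^o) *
      rnorm (Delta b f x) <= 2 * (r * K) * M.
    by move=> *; apply: ler_pM; rewrite ?rnorm_ge0 ?coef ?w_le.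
  have := bnd t2 t3 t1 J2 J3 J1 t12 t13; have := bnd t3 t1 t2 J3 J1 J2 t13 t11.
  have := bnd t1 t2 t3 J1 J2 J3 t11 t12.
  have rKM : 0 < r * K * M by apply: mulr_gt0 => //; exact: mulr_gt0.
  by move=> h1 h2 h3; move: (lerD (lerD h3 h2) h1) => /le_trans; apply; lra.
apply: le_trans (rnorm_lerB _ (q t1 *: P)) _; rewrite rnormZ.
have : rnorm (q t1) * rnorm P <= K / c * (r + r).
  by apply: ler_pM; rewrite ?rnorm_ge0.
have -> : e = K / c * (r + r) + 12 * (r * (K * M)).
  have -> : e = r * D by rewrite /r divfK// gt_eqF.
  by rewrite /D; ring.
by move: Q_P; lra.
Qed.

End Uniformization.

(** * The difference property *)

Section DifferenceWithMean.
Context {R : realType} {X : completeNormedModType R[i]}.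
Variables (J : set R) (J_adm : admissible_interval J).
Variables (gamma : R -> R[i]^o) (c G : R).
Hypothesis c0 : 0 < c.
Hypothesis gamma_ge : forall t, J t -> c <= rnorm (gamma t).
Hypothesis gamma_le : forall t, J t -> rnorm (gamma t) <= G.
Hypothesis gamma_luc : luc J gamma.
Hypothesis gamma_mean : forall h : R, 0 < h -> C0 J (Mean h gamma).
Hypothesis gamma_quot : forall a : R, 0 < a ->
  unif_continuous_on J (fun t => gamma (t + a) / gamma t : R[i]^o).

Let J_up := @admissible_up R J J_adm.

(** At [t] the function [f - Mean h f] is the mean of [- Delta s f t] over
    [s <= h], so that it inherits every estimate on the increments that is uniform
    in [s] and stable under averaging. *)
Lemma difference_with_mean (f : R -> X) (h : R) : L1loc J f -> 0 < h ->
  (forall a : R, 0 < a -> sum_class J (BUC J : set (R -> X))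
    (mul_class J gamma (BUC J : set (R -> X))) (Delta a f)) ->
  sum_class J (BUC J : set (R -> X)) (mul_class J gamma (BUC J : set (R -> X)))
    (fun t => f t - Mean h f t).
Proof.
move=> f_L1 h0 f_Delta; pose W t := f t - Mean h f t; pose H := 4 * h.
have H0 : 0 < H by rewrite mulr_gt0.
have J_sub t : J (t - H) -> J t.
  by move=> Jt; rewrite -(subrK H t); apply: J_up => //; exact: ltW.
have f_mean t : J t -> is_mean h (fun s => f (t + s)) (Mean h f t).
  move=> Jt; exact: (L1loc_is_mean (@complete_sequentially R X) J_up f_L1 Jt h0).
have W_mean t : J t -> is_mean h (fun s => - Delta s f t) (W t).
  move=> Jt; apply: (eq_is_mean _ (is_meanB (is_mean_cst (f t) h0) (f_mean t Jt))).
  by move=> s _; rewrite /Delta opprB.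
have [D_luc [M hM]] := sum_class_luc_bounded gamma_le gamma_luc (f_Delta H H0).
(* the increments of [f] are controlled away from the endpoint of [J] only; this
   identity brings the control of [W] back to the whole of [J] *)
have W_shift t : J t -> W t = W (t + H) - (Delta H f t - Mean h (Delta H f) t).
  move=> Jt; have JtH : J (t + H) by apply: J_up => //; exact: ltW.
  have -> : Mean h (Delta H f) t = Mean h f (t + H) - Mean h f t.
    apply: Mean_unique h0 _; apply: (eq_is_mean _ (is_meanB (f_mean _ JtH) (f_mean _ Jt))).
    by move=> s _; rewrite /Delta [t + s + H]addrAC.
  by rewrite /W /Delta !opprB !addrA [RHS](ACl (5*4*(1*6)*(2*3))) /= subrr addNr !addr0.
have DL1 := luc_L1loc D_luc.
have MD_luc : luc J (Mean h (Delta H f)).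
  exact: (luc_Mean (@complete_sequentially R X) J_up D_luc h0).
have MD_le t : J t -> rnorm (Mean h (Delta H f) t) <= M.
  move=> Jt; exact: (Mean_bounded (@complete_sequentially R X) J_up DL1 hM Jt h0).
have [B hB] := Delta_uniformly_bounded J_adm gamma_le gamma_luc f_L1 f_Delta h0.
have W_le t : J t -> rnorm (W t) <= B + (M + M).
  move=> Jt; rewrite W_shift//; apply: le_trans (rnormB _ _) _; apply: lerD.
    have JtH : J (t + H) by apply: J_up => //; exact: ltW.
    apply: (is_mean_bound h0 (W_mean _ JtH)) => s sh; rewrite rnormN.
    by apply: hB => //; rewrite addrK.
  by apply: le_trans (rnormB _ _) _; rewrite lerD ?hM ?MD_le.
have W_luc : luc J W.
  move=> T; apply: (@eq_uc _ _ _ (fun t => W (t + H) +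
      (Mean h (Delta H f) t + - Delta H f t))) => [t [Jt _]|].
    by rewrite [RHS]W_shift// [in RHS](opprB (Delta H f t)).
  apply: ucD; last apply: ucD; last 2 first.
  - exact: MD_luc.
  - move=> e e0; have [d d0 hd] := D_luc T e e0; exists d => // s t Ss St st.
    by rewrite -opprD rnormN; exact: hd.
  move=> e e0; have e2 : 0 < e / 2 by rewrite divr_gt0.
  have [d d0 hd] := Delta_equi_luc J_adm gamma_le gamma_luc f_L1 f_Delta (T + H) h0 e2.
  exists d => // s t [Js /= sT] [Jt /= tT] st.
  have JsH : J (s + H) by apply: J_up => //; exact: ltW.
  have JtH : J (t + H) by apply: J_up => //; exact: ltW.
  apply: (@le_lt_trans _ _ (e / 2)); last by lra.
  apply: (is_mean_bound h0 (is_meanB (W_mean _ JsH) (W_mean _ JtH))) => r rh.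
  rewrite -opprD rnormN; apply: hd => //; rewrite ?addrK//.
  - by apply: le_trans (ler_normD _ _) _; rewrite (gtr0_norm H0) lerD2r.
  - by apply: le_trans (ler_normD _ _) _; rewrite (gtr0_norm H0) lerD2r.
  - by rewrite opprD addrACA subrr addr0.
apply: (reconstruction J_adm c0 gamma_ge gamma_le gamma_luc gamma_mean W_luc W_le).
move=> e e0.
have [d d0 hd] := Delta_equi_det J_adm c0 gamma_ge gamma_le gamma_luc gamma_quot
  f_L1 f_Delta h0 e0.
have [T hT] := admissible_back J_adm (ltW H0).
exists d => //; exists T => t1 t2 t3 Jt1 Jt2 Jt3 t1T t2T t3T t12 t13 _.
apply: (is_mean_bound h0 (is_mean_lin3 (g := fun t s => - Delta s f t) (w := W)
  _ _ _ (W_mean _ Jt1) (W_mean _ Jt2) (W_mean _ Jt3))).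
move=> s sh; rewrite (_ : lin3 _ (gamma t2 - gamma t3)
    (gamma t3 - gamma t1) (gamma t1 - gamma t2) t1 t2 t3 =
    - det gamma (Delta s f) t1 t2 t3); last first.
  by rewrite /det /lin3 !scalerN -!opprD.
by rewrite rnormN; apply: hd => //; exact: hT.
Qed.

End DifferenceWithMean.

Unset Implicit Arguments.
Set Strict Implicit.

Theorem corollary6p6 (R : realType) (X : completeNormedModType R[i])
    (X_neq0 : exists x : X, x != 0)
    (J : set R) (J_adm : admissible_interval J)
    (gamma : R -> R[i]^o)
    (gamma_BC : BC J gamma)
    (gamma_inf : 0 < inf [set rnorm (gamma t) | t in J])
    (gamma_MC0 : MClass J (C0 J) gamma)
    (gamma_quot : exists2 eps0 : R, 0 < eps0 &
       forall a : R, 0 < a -> a < eps0 ->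
         BUC J (fun t => translate a gamma t / gamma t)) :
  satisfies_Delta J (sum_class J (BUC J : set (R -> X))
                                 (mul_class J gamma (BUC J : set (R -> X)))).
Proof.
have [gamma_cont /boundedP[G gamma_le]] := gamma_BC.
have [_ gamma_mean] := gamma_MC0.
pose c := inf [set rnorm (gamma t) | t in J].
have gamma_ge t : J t -> c <= rnorm (gamma t).
  move=> Jt; apply: ge_inf; last by exists t.
  by exists 0 => _ [s _ <-]; exact: rnorm_ge0.
have gamma_q : exists2 eps0 : R, 0 < eps0 & forall a : R, 0 < a -> a < eps0 ->
    unif_continuous_on J (fun t => gamma (t + a) / gamma t : R[i]^o).
  by have [eps0 eps0_gt0 hq] := gamma_quot; exists eps0 => // a a0 /(hq a a0)[].
move=> f f_L1 f_Delta h h0.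
have gamma_luc
  := gamma_luc_of_quotients J_adm gamma_inf gamma_ge gamma_le gamma_cont gamma_q.
have gamma_quots := quotient_uc J_adm gamma_inf gamma_ge gamma_le gamma_q.
exact: (difference_with_mean J_adm gamma_inf gamma_ge gamma_le gamma_luc gamma_mean
  gamma_quots f_L1 h0 f_Delta).
Qed.
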